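(* Let $(M,\alpha_1,\alpha_2,\phi,g)$ be a metric contact pair with decomposable $\phi$. Then the leaves of the characteristic foliations $\mathcal{G}_1$ and $\mathcal{G}_2$ of the $2$-forms $d\alpha_1$ and $d\alpha_2$ are minimal submanifolds of $(M,g)$.
   Context: All objects are smooth. A contact pair of type $(h,k)$ on a manifold $M$ of dimension $2h+2k+2$ is a pair of $1$-forms $(\alpha_1,\alpha_2)$ such that $\alpha_1\wedge(d\alpha_1)^h\wedge\alpha_2\wedge(d\alpha_2)^k$ is a volume form, $(d\alpha_1)^{h+1}=0$ and $(d\alpha_2)^{k+1}=0$. Convention: $2\,d\alpha(X,Y)=X\alpha(Y)-Y\alpha(X)-\alpha([X,Y])$ for $1$-forms. For $i=1,2$, the integrable subbundle $T\mathcal{F}_i=\{X:\alpha_i(X)=0,\ d\alpha_i(X,Y)=0\ \forall Y\}$ defines the characteristic foliation $\mathcal{F}_i$ of $\alpha_i$. The Reeb vector fields $Z_1,Z_2$ are the unique vector fields with $\alpha_i(Z_j)=\delta_{ij}$ and $i_{Z_i}d\alpha_j=0$ for all $i,j\in\{1,2\}$. A contact pair structure $(\alpha_1,\alpha_2,\phi)$ is a contact pair together with a $(1,1)$-tensor field $\phi$ with $\phi^2=-\mathrm{Id}+\alpha_1\otimes Z_1+\alpha_2\otimes Z_2$ and $\phi Z_1=\phi Z_2=0$. $\phi$ is decomposable if $\phi(T\mathcal{F}_i)\subset T\mathcal{F}_i$ for $i=1,2$. A metric contact pair $(M,\alpha_1,\alpha_2,\phi,g)$ is a contact pair structure with a Riemannian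 metric $g$ that is associated: $g(X,\phi Y)=(d\alpha_1+d\alpha_2)(X,Y)$ and $g(X,Z_i)=\alpha_i(X)$ for $i=1,2$ and all $X,Y$. For $i=1,2$, the characteristic foliation $\mathcal{G}_i$ of $d\alpha_i$ is the foliation of $M$ tangent to the (integrable) subbundle $T\mathcal{G}_i=\{X: d\alpha_i(X,Y)=0\ \forall Y\}$. *)

(* Defs.v *)
(* A smooth manifold is a second countable Hausdorff space
   with a smooth atlas; tensor fields are given by their components in the
   charts of the atlas, subject to the transformation law.

   Tangent vectors are row vectors, so a linear map acts by right
   multiplication, as in the library's Jacobian: the differential of f at x is
   v |-> v *m 'J f x.  Accordingly the components at x of
     - a vector field are a row vector,
     - a 1-form a are a column vector, with a(v) = v *m a,
     - a (1,1)-tensor field phi are a square matrix, with phi(v) = v *m phi,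
     - a metric g are a square matrix, with g(u, v) = u *m g *m v^T. *)
From mathcomp Require Import all_boot all_order all_algebra all_fingroup.
From mathcomp Require Import all_classical all_reals all_analysis.

Set Implicit Arguments.
Unset Strict Implicit.
Unset Printing Implicit Defensive.

Import Order.TTheory GRing.Theory Num.Theory.
Import numFieldNormedType.Exports.

Local Open Scope classical_set_scope.
Local Open Scope ring_scope.

Section Smooth.
Context {R : realType} {n : nat}.
Implicit Types (U : set 'rV[R]_n).

Fixpoint Ck_on (k : nat) U (f : 'rV[R]_n -> R^o) : Prop :=
  match k with
  | 0 => forall x, U x -> {for x, continuous f}
  | k'.+1 => (forall x, U x -> differentiable f x) /\
             forall i : 'I_n, Ck_on k' U (fun x => 'D_(delta_mx 0 i) f x)
  end.

(* Meant for an open U; the values of F outside U are irrelevant. *)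
Definition smooth_on {p q : nat} U (F : 'rV[R]_n -> 'M[R]_(p, q)) : Prop :=
  forall i j k, Ck_on k U (fun x => F x i j).

End Smooth.

Section Manifolds.
Context {R : realType}.

(* cinv is total, but only its values on cmap @` cdom are relevant. *)
Record chart (n : nat) (M : topologicalType) := Chart {
  cdom : set M;
  cmap : M -> 'rV[R]_n;
  cinv : 'rV[R]_n -> M;
  cdom_open : open cdom;
  cimg_open : open (cmap @` cdom);
  cmapK : forall p, cdom p -> cinv (cmap p) = p;
  cmap_continuous : {within cdom, continuous cmap};
  cinv_continuous : {within cmap @` cdom, continuous cinv} }.

Definition transition n (M : topologicalType) (c c' : chart n M) :
  'rV[R]_n -> 'rV[R]_n := cmap c' \o cinv c.

Definition overlap n (M : topologicalType) (c c' : chart n M) :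
  set 'rV[R]_n := cmap c @` (cdom c `&` cdom c').

Record manifold (n : nat) := Manifold {
  mspace :> topologicalType;
  atlas : set (chart n mspace);
  atlas_cover : forall p, exists2 c, atlas c & cdom c p;
  atlas_smooth : forall c c', atlas c -> atlas c' ->
    smooth_on (overlap c c') (transition c c');
  manifold_hausdorff : hausdorff_space mspace;
  manifold_second_countable : @second_countable mspace }.

(* x is the coordinate vector, in the chart c of the atlas, of a point of M. *)
Definition in_chart n (M : manifold n) (c : chart n M) (x : 'rV[R]_n) : Prop :=
  atlas c /\ (cmap c @` cdom c) x.

End Manifolds.
Arguments manifold : clear implicits.
Arguments chart : clear implicits.

Section Tensors.
Context {R : realType} {n : nat} (M : manifold R n).
Implicit Types (c : chart R n M) (x u v : 'rV[R]_n).

Record vector_field := VectorField {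
  vf_comp :> chart R n M -> 'rV[R]_n -> 'rV[R]_n;
  vf_smooth : forall c, atlas c -> smooth_on (cmap c @` cdom c) (vf_comp c);
  vf_transform : forall c c' x, atlas c -> atlas c' -> overlap c c' x ->
    vf_comp c' (transition c c' x) = vf_comp c x *m 'J (transition c c') x }.

Record one_form := OneForm {
  of_comp :> chart R n M -> 'rV[R]_n -> 'cV[R]_n;
  of_smooth : forall c, atlas c -> smooth_on (cmap c @` cdom c) (of_comp c);
  of_transform : forall c c' x, atlas c -> atlas c' -> overlap c c' x ->
    of_comp c x = 'J (transition c c') x *m of_comp c' (transition c c' x) }.

Record endo_field := EndoField {
  ef_comp :> chart R n M -> 'rV[R]_n -> 'M[R]_n;
  ef_smooth : forall c, atlas c -> smooth_on (cmap c @` cdom c) (ef_comp c);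
  ef_transform : forall c c' x, atlas c -> atlas c' -> overlap c c' x ->
    ef_comp c x *m 'J (transition c c') x =
    'J (transition c c') x *m ef_comp c' (transition c c' x) }.

Record riemannian_metric := RiemannianMetric {
  rm_comp :> chart R n M -> 'rV[R]_n -> 'M[R]_n;
  rm_smooth : forall c, atlas c -> smooth_on (cmap c @` cdom c) (rm_comp c);
  rm_transform : forall c c' x, atlas c -> atlas c' -> overlap c c' x ->
    rm_comp c x = 'J (transition c c') x *m rm_comp c' (transition c c' x) *m
                  ('J (transition c c') x)^T;
  rm_sym : forall c x, in_chart c x -> (rm_comp c x)^T = rm_comp c x;
  rm_pos : forall c x, in_chart c x -> forall v, v != 0 ->
    0 < (v *m rm_comp c x *m v^T) 0 0 }.

Definition form_eval (a : one_form) c x v : R := (v *m a c x) 0 0.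

Definition metric_eval (g : riemannian_metric) c x u v : R :=
  (u *m g c x *m v^T) 0 0.

(* 2 da(X, Y) = X a(Y) - Y a(X) - a([X, Y]), evaluated on the fields X, Y with
   constant components u, v in the chart c, for which [X, Y] = 0. *)
Definition ext_d (a : one_form) c x u v : R :=
  2^-1 * ('D_u (fun y => form_eval a c y v : R^o) x -
          'D_v (fun y => form_eval a c y u : R^o) x).

End Tensors.

Section Wedge.
Context {R : realType} {V : Type}.

Definition form1 (a : V -> R) : ('I_1 -> V) -> R := fun v => a (v ord0).

Definition form2 (b : V -> V -> R) : ('I_2 -> V) -> R :=
  fun v => b (v ord0) (v ord_max).

(* The normalization 1/(p+q)! goes with the factor 2 in ext_d. *)
Definition wedge {p q : nat} (a : ('I_p -> V) -> R) (b : ('I_q -> V) -> R) :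
    ('I_(p + q) -> V) -> R := fun v =>
  ((p + q)`!)%:R^-1 * \sum_(s : 'S_(p + q)) (-1) ^+ s *
    (a (fun i => v (s (lshift q i))) * b (fun j => v (s (rshift p j)))).

Fixpoint wedge_exp (b : ('I_2 -> V) -> R) (h : nat) : ('I_(h * 2) -> V) -> R :=
  match h with
  | 0 => fun _ => 1
  | h'.+1 => wedge b (@wedge_exp b h')
  end.

End Wedge.
Arguments wedge_exp {R V} b h _.

Section ContactPairs.
Context {R : realType} {n : nat} {M : manifold R n}.
Implicit Types (a : one_form M) (phi : endo_field M) (Z : vector_field M)
  (g : riemannian_metric M).

(* When n = 2h + 2k + 2 the first form has degree n, so that it is a volume
   form iff it vanishes nowhere. *)
Record contact_pair (h k : nat) a1 a2 : Prop := ContactPair {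
  cp_volume : forall c x, in_chart c x -> exists v,
    wedge (form1 (form_eval a1 c x)) (wedge (wedge_exp (form2 (ext_d a1 c x)) h)
      (wedge (form1 (form_eval a2 c x)) (wedge_exp (form2 (ext_d a2 c x)) k))) v
    <> 0;
  cp_d1 : forall c x, in_chart c x -> forall v,
    wedge_exp (form2 (ext_d a1 c x)) h.+1 v = 0;
  cp_d2 : forall c x, in_chart c x -> forall v,
    wedge_exp (form2 (ext_d a2 c x)) k.+1 v = 0 }.

Record reeb_fields a1 a2 Z1 Z2 : Prop := ReebFields {
  reeb_11 : forall c x, in_chart c x -> form_eval a1 c x (Z1 c x) = 1;
  reeb_12 : forall c x, in_chart c x -> form_eval a1 c x (Z2 c x) = 0;
  reeb_21 : forall c x, in_chart c x -> form_eval a2 c x (Z1 c x) = 0;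
  reeb_22 : forall c x, in_chart c x -> form_eval a2 c x (Z2 c x) = 1;
  reeb_d11 : forall c x, in_chart c x -> forall v, ext_d a1 c x (Z1 c x) v = 0;
  reeb_d12 : forall c x, in_chart c x -> forall v, ext_d a1 c x (Z2 c x) v = 0;
  reeb_d21 : forall c x, in_chart c x -> forall v, ext_d a2 c x (Z1 c x) v = 0;
  reeb_d22 : forall c x, in_chart c x -> forall v, ext_d a2 c x (Z2 c x) v = 0 }.

(* Z1 and Z2 are determined by a1 and a2. *)
Record contact_pair_structure (h k : nat) a1 a2 Z1 Z2 phi : Prop :=
  ContactPairStructure {
  cps_pair : contact_pair h k a1 a2;
  cps_reeb : reeb_fields a1 a2 Z1 Z2;
  cps_sqr : forall c x, in_chart c x ->
    phi c x *m phi c x = - 1%:M + a1 c x *m Z1 c x + a2 c x *m Z2 c x;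
  cps_Z1 : forall c x, in_chart c x -> Z1 c x *m phi c x = 0;
  cps_Z2 : forall c x, in_chart c x -> Z2 c x *m phi c x = 0 }.

Record metric_contact_pair (h k : nat) a1 a2 Z1 Z2 phi g : Prop :=
  MetricContactPair {
  mcp_structure : contact_pair_structure h k a1 a2 Z1 Z2 phi;
  mcp_phi : forall c x, in_chart c x -> forall u v,
    metric_eval g c x u (v *m phi c x) = ext_d a1 c x u v + ext_d a2 c x u v;
  mcp_Z1 : forall c x, in_chart c x -> forall u,
    metric_eval g c x u (Z1 c x) = form_eval a1 c x u;
  mcp_Z2 : forall c x, in_chart c x -> forall u,
    metric_eval g c x u (Z2 c x) = form_eval a2 c x u }.

Definition TF a (c : chart R n M) (x : 'rV[R]_n) : set 'rV[R]_n :=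
  [set v | form_eval a c x v = 0 /\ forall w, ext_d a c x v w = 0].

Definition TG a (c : chart R n M) (x : 'rV[R]_n) : set 'rV[R]_n :=
  [set v | forall w, ext_d a c x v w = 0].

Definition decomposable a1 a2 phi : Prop :=
  forall c x, in_chart c x -> forall v,
    (TF a1 c x v -> TF a1 c x (v *m phi c x)) /\
    (TF a2 c x v -> TF a2 c x (v *m phi c x)).

End ContactPairs.

Section Submanifolds.
Context {R : realType} {m n : nat} {L : manifold R m} {M : manifold R n}.
Implicit Types (f : L -> M).

Definition local_rep f (c : chart R m L) (c' : chart R n M) :
  'rV[R]_m -> 'rV[R]_n := cmap c' \o f \o cinv c.

Definition local_dom f (c : chart R m L) (c' : chart R n M) :
  set 'rV[R]_m :=
  cmap c @` (cdom c `&` f @^-1` cdom c').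

Definition smooth_map f : Prop :=
  continuous f /\
  forall c c', atlas c -> atlas c' ->
    smooth_on (local_dom f c c') (local_rep f c c').

Definition immersion f : Prop :=
  smooth_map f /\
  forall c c' y, atlas c -> atlas c' -> local_dom f c c' y ->
    row_free ('J (local_rep f c c') y).

(* A nonempty connected, injectively immersed submanifold whose tangent space
   (the row space of the Jacobian) is everywhere the given one. *)
Record connected_integral_manifold
    (D : chart R n M -> 'rV[R]_n -> set 'rV[R]_n) f : Prop :=
  ConnectedIntegralManifold {
  cim_nonempty : [set: L] !=set0;
  cim_connected : connected [set: L];
  cim_injective : injective f;
  cim_immersion : immersion f;
  cim_tangent : forall c c' y, atlas c -> atlas c' -> local_dom f c c' y ->
    forall v, D c' (local_rep f c c' y) v <->
              (v <= 'J (local_rep f c c') y)%MS }.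

End Submanifolds.

(* Leaves are maximal connected integral manifolds, in general only immersed. *)
Definition leaf {R : realType} {m n : nat} {L : manifold R m}
    {M : manifold R n} (D : chart R n M -> 'rV[R]_n -> set 'rV[R]_n)
    (f : L -> M) : Prop :=
  connected_integral_manifold D f /\
  forall m' (L' : manifold R m') (f' : L' -> M),
    connected_integral_manifold D f' -> range f `<=` range f' ->
    range f' `<=` range f.

Section MeanCurvature.
Context {R : realType} {n : nat} {M : manifold R n} (g : riemannian_metric M).

Definition metric_partial (c : chart R n M) x (i j l : 'I_n) : R :=
  'D_(delta_mx 0 i) (fun y => g c y j l : R^o) x.

Definition christoffel (c : chart R n M) x (k i j : 'I_n) : R :=
  2^-1 * \sum_(l < n) invmx (g c x) k l *
    (metric_partial c x i j l + metric_partial c x j i l -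
     metric_partial c x l i j).

Definition christoffel_vec (c : chart R n M) (x u v : 'rV[R]_n) : 'rV[R]_n :=
  \row_k \sum_(i < n) \sum_(j < n) christoffel c x k i j * u 0 i * v 0 j.

Context {m : nat} {L : manifold R m} (f : L -> M).
Variables (c : chart R m L) (c' : chart R n M) (y : 'rV[R]_m).
Let r := local_rep f c c'.
Let G := g c' (r y).

Definition induced_metric : 'M[R]_m := 'J r y *m G *m ('J r y)^T.

(* The component of w orthogonal to the row space of 'J r y. *)
Definition normal_part (w : 'rV[R]_n) : 'rV[R]_n :=
  w - w *m G *m ('J r y)^T *m invmx induced_metric *m 'J r y.

(* The Levi-Civita derivative, along f, of the b-th coordinate field of L in
   the direction of the a-th one. *)
Definition cov_deriv (a b : 'I_m) : 'rV[R]_n :=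
  'D_(delta_mx 0 a) (fun z => 'D_(delta_mx 0 b) r z) y +
  christoffel_vec c' (r y) ('D_(delta_mx 0 a) r y) ('D_(delta_mx 0 b) r y).

Definition second_fundamental_form (a b : 'I_m) : 'rV[R]_n :=
  normal_part (cov_deriv a b).

Definition mean_curvature : 'rV[R]_n :=
  m%:R^-1 *: \sum_(a < m) \sum_(b < m)
    invmx induced_metric a b *: second_fundamental_form a b.

End MeanCurvature.

Definition minimal_immersion {R : realType} {m n : nat} {L : manifold R m}
    {M : manifold R n} (g : riemannian_metric M) (f : L -> M) : Prop :=
  immersion f /\
  forall c c' y, atlas c -> atlas c' -> local_dom f c c' y ->
    mean_curvature g f c c' y = 0.

(* Main.v *)
Require Import Defs.
From mathcomp Require Import all_boot all_order all_algebra all_fingroup.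
From mathcomp Require Import all_classical all_reals all_analysis.
From mathcomp Require Import ring lra.

Set Implicit Arguments.
Unset Strict Implicit.
Unset Printing Implicit Defensive.

Import Order.TTheory GRing.Theory Num.Theory.
Import numFieldNormedType.Exports.

Local Open Scope classical_set_scope.
Local Open Scope ring_scope.

(** The 2-form Omega(X, Y) = g(X, phi Y) of a metric contact pair is the exact
    form d(a1 + a2).  As in almost Kaehler geometry, where invariant
    submanifolds are minimal, this closedness forces minimality of the
    phi-invariant submanifolds, provided that they are tangent to Z1 and Z2
    ([invariant_submanifold_minimal]).  The leaves of G_i are such: TG_i
    contains both Reeb fields by definition of these, it is the sum of TF_i and
    of the line of Z_i, phi preserves TF_i by decomposability and kills Z_i
    ([TG_invariant]).

    To see minimality, let X_a be the coordinate fields of the submanifold,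
    i.e. the rows of the Jacobian J of a local representation, and let N be
    normal at a point and have constant components in the chart.  Put
    h_ab = g(X_a, X_b), p_ab = X_a (g(N, X_b)) and q_ab = (D_N g)(X_a, X_b).
    The formula for the Christoffel symbols shows that twice the normal
    curvature in the direction of N is p + p^T - q, so that the claim is
    tr ((2p - q) h^-1) = 0 ([cov_deriv_trace]).  Write F for the matrix of phi
    on the tangent space, J phi = F J.  Closedness of Omega, evaluated on X_a,
    X_b and N, becomes

      p F^T - F p^T = J (D_N (g phi^T)) J^T          ([second_form_closed]),

    and now one multiplies by h^-1 F and takes traces.  As phi^2 is -1 up to
    Reeb terms, the left-hand side turns into 2 tr (p h^-1) and the part of the
    right-hand side where g is differentiated into tr (q h^-1), both up to Reeb
    terms.  In the remaining part phi is differentiated; it is the tangential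
    trace of phi (D_N phi), half of the tangential trace of D_N (phi^2), which
    vanishes because a_i(Z_i) is constant.  What is left
    ([second_form_trace]) is

      tr ((2p - q) h^-1) = (2p - q)(Z1, Z1) + (2p - q)(Z2, Z2),

    and (2p - q)(Z_i, Z_i) is a multiple of da_i(Z_i, N) = 0
    ([second_form_reeb_vanish]): the integral curves of Z_i are geodesics.

    Two facts of calculus carry this: second derivatives commute
    ([derive_swap]), whence d(da) = 0 and the symmetry of the derivatives of J;
    and if a field Y along the submanifold is tangent to it, then the normal
    part of its derivative at a point depends only on the value of Y there
    ([derive_tangent]). *)

(** * Positive definite matrices and the trace identity *)

Section PositiveDefinite.
Context {R : realFieldType} {n : nat} (G : 'M[R]_n).
Context (G_pos : forall v : 'rV[R]_n, v != 0 -> 0 < (v *m G *m v^T) 0 0).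

Lemma posdef_norm_eq0 (v : 'rV[R]_n) : v *m G *m v^T = 0 -> v = 0.
Proof.
move=> v0; apply/eqP/negPn/negP => /G_pos.
by rewrite v0 mxE ltxx.
Qed.

Lemma posdef_congr_unit m (J : 'M[R]_(m, n)) :
  row_free J -> J *m G *m J^T \in unitmx.
Proof.
move=> Jfree; rewrite -row_free_unit; apply/inj_row_free => v vh.
apply/(row_free_inj Jfree); rewrite mul0mx; apply: posdef_norm_eq0.
by rewrite trmx_mul !mulmxA -2!(mulmxA v) vh mul0mx.
Qed.

Lemma posdef_unit : G \in unitmx.
Proof.
have := @posdef_congr_unit n 1%:M.
by rewrite mul1mx trmx1 mulmx1; apply; rewrite row_free_unit unitmx1.
Qed.

End PositiveDefinite.

Lemma trmx11 {R : Type} (A : 'M[R]_1) : A^T = A.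
Proof. by apply/matrixP => i j; rewrite mxE !ord1. Qed.

Lemma mxtrace_row_col {R : comNzRingType} {n : nat} (u : 'rV[R]_n) (a : 'cV[R]_n) :
  \tr (a *m u) = (u *m a) 0 0.
Proof. by rewrite mxtrace_mulC /mxtrace big_ord1. Qed.

(** The linear algebra at one point.  Primes denote derivatives in a normal
    direction N, the rows of J span the tangent space, and e1, e2 are the
    coordinates of the Reeb vectors z1, z2 in this basis. *)
Section Trace.
Context {R : realFieldType} {m n : nat}.
Context (J : 'M[R]_(m, n)) (G phi G' phi' : 'M[R]_n) (F p : 'M[R]_m).
Context (z1 z2 z1' z2' : 'rV[R]_n) (a1 a2 a1' a2' : 'cV[R]_n) (e1 e2 : 'rV[R]_m).
Context (GT : G^T = G).
Context (phiG : phi *m G = - (G *m phi^T)).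
Context (Jphi : J *m phi = F *m J).
Context (Jfree : row_free J).
Context (phi2 : phi *m phi = - 1%:M + a1 *m z1 + a2 *m z2).
Context (z1J : z1 = e1 *m J).
Context (z2J : z2 = e2 *m J).
Context (a1E : G *m z1^T = a1).
Context (a2E : G *m z2^T = a2).
Context (phi2' :
  phi' *m phi + phi *m phi' = a1' *m z1 + a1 *m z1' + (a2' *m z2 + a2 *m z2')).
Context (az1' : z1' *m a1 + z1 *m a1' = 0).
Context (az2' : z2' *m a2 + z2 *m a2' = 0).
Context (h q : 'M[R]_m) (hE : h = J *m G *m J^T) (qE : q = J *m G' *m J^T).
Context (hunit : h \in unitmx).
Context (hyp_p :
  p *m F^T - F *m p^T = J *m (G' *m phi^T + G *m phi'^T) *m J^T).

Let hT : h^T = h. Proof. by rewrite hE !trmx_mul trmxK GT mulmxA. Qed.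
Let ihT : (invmx h)^T = invmx h. Proof. by rewrite trmx_inv hT. Qed.

(* F is skew for h, since phi is skew for G. *)
Let Fh : F *m h = - (h *m F^T).
Proof.
rewrite hE !mulmxA -Jphi -!mulmxA -trmx_mul -Jphi trmx_mul !mulmxA.
by rewrite -(mulmxA J phi G) phiG mulmxN mulNmx !mulmxA.
Qed.

Let Fih : F^T *m invmx h = - (invmx h *m F).
Proof.
have -> : F^T = - (invmx h *m (F *m h)) by rewrite Fh mulmxN opprK mulKmx.
by rewrite mulNmx -!mulmxA mulmxV // mulmx1.
Qed.

(* The inverse metric on the part of the tangent space orthogonal to the Reeb
   vectors. *)
Let S := invmx h - e1^T *m e1 - e2^T *m e2.

Let ST : S^T = S.
Proof. by rewrite /S !raddfB /= !trmx_mul !trmxK ihT. Qed.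

Let F2 : invmx h *m F *m F = - S.
Proof.
have FF : F *m F = - 1%:M + h *m (e1^T *m e1 + e2^T *m e2).
  apply: (row_free_inj Jfree).
  rewrite -mulmxA -Jphi mulmxA -Jphi -mulmxA phi2 !mulmxDr !mulmxDl mulmxN.
  rewrite mulNmx mulmx1 mul1mx -a1E -a2E z1J z2J !trmx_mul hE !mulmxA -addrA.
  by [].
rewrite -mulmxA FF !mulmxDr mulmxN mulmx1 !mulKmx // /S.
by rewrite -addrA -opprD opprB addrC.
Qed.

(* The orthogonal projection onto the tangent space; its trace against an
   endomorphism is the tangential trace of the latter. *)
Let pi := G *m J^T *m invmx h *m J.

Let phi_pi : phi *m pi = pi *m phi.
Proof.
rewrite /pi !mulmxA phiG -(mulmxA _ J phi) Jphi mulmxA !mulNmx.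
rewrite -(mulmxA G phi^T) -trmx_mul Jphi trmx_mul mulmxA -(mulmxA _ F^T) Fih.
by rewrite mulmxN mulNmx opprK !mulmxA.
Qed.

Let z_pi (z : 'rV[R]_n) e : z = e *m J -> z *m pi = z.
Proof.
move=> ->; rewrite /pi !mulmxA -2!(mulmxA e) -hE.
by rewrite mulmxK.
Qed.

Let pi_a (z : 'rV[R]_n) e : z = e *m J -> pi *m (G *m z^T) = G *m z^T.
Proof.
move=> ->; rewrite trmx_mul.
have piE X : pi *m X = G *m J^T *m (invmx h *m (J *m X)) :> 'cV_n.
  by rewrite /pi !mulmxA.
by rewrite piE (mulmxA J) (mulmxA (J *m G)) -hE mulKmx // -mulmxA.
Qed.

(* pi commutes with phi, so this is half of the trace of pi against the
   derivative of phi^2, that is, of the sum of the a_i z_i.  That trace is the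
   derivative of the sum of the a_i (z_i). *)
Let tr_phi' : \tr (pi *m phi *m phi') = 0.
Proof.
have tr2 : \tr (pi *m (phi' *m phi + phi *m phi')) = \tr (pi *m phi *m phi') *+ 2.
  rewrite mulmxDr mxtraceD mulr2n !mulmxA; congr (_ + _).
  by rewrite mxtrace_mulC mulmxA phi_pi.
have tr_az (z z' : 'rV[R]_n) (a a' : 'cV[R]_n) e : z = e *m J -> G *m z^T = a ->
    z' *m a + z *m a' = 0 -> \tr (pi *m (a' *m z + a *m z')) = 0.
  move=> zJ aE az; rewrite mulmxDr mxtraceD !mulmxA !mxtrace_row_col -aE.
  rewrite (pi_a zJ) aE mulmxA (z_pi zJ).
  by move/matrixP/(_ 0 0): az; rewrite !mxE addrC.
suff /eqP : \tr (pi *m phi *m phi') *+ 2 = 0 by rewrite mulrn_eq0 => /eqP.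
rewrite -tr2 phi2' mulmxDr mxtraceD.
by rewrite (tr_az _ _ _ _ _ z1J a1E az1') (tr_az _ _ _ _ _ z2J a2E az2') addr0.
Qed.

(** [hyp_p] is multiplied by [invmx h *m F], whose product with F^T or F on the
    other side is the inverse metric S or its opposite; the symmetry of S makes
    the two terms in p equal. *)
Lemma trace_identity :
  \tr ((p *+ 2 - q) *m invmx h) =
  (e1 *m (p *+ 2 - q) *m e1^T) 0 0 + (e2 *m (p *+ 2 - q) *m e2^T) 0 0.
Proof.
have trS X : \tr (X *m S) =
    \tr (X *m invmx h) - (e1 *m X *m e1^T) 0 0 - (e2 *m X *m e2^T) 0 0.
  rewrite /S !mulmxBr !raddfB /= !mulmxA !mxtrace_row_col !mulmxA.
  by [].
suff: \tr ((p *+ 2 - q) *m S) = 0.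
  by rewrite trS => /eqP; rewrite -addrA -opprD subr_eq0 => /eqP.
have := congr1 (fun X => \tr (X *m (invmx h *m F))) hyp_p.
have FihF : F^T *m (invmx h *m F) = S by rewrite mulmxA Fih mulNmx F2 opprK.
have trpF : \tr (p *m F^T *m (invmx h *m F)) = \tr (p *m S) by rewrite -mulmxA FihF.
have trFp : \tr (F *m p^T *m (invmx h *m F)) = - \tr (p *m S).
  rewrite -(mulmxA F) mxtrace_mulC -mulmxA F2 mulmxN raddfN /=.
  by rewrite -mxtrace_tr trmx_mul trmxK ST mxtrace_mulC.
have trq : \tr (J *m (G' *m phi^T) *m J^T *m (invmx h *m F)) = \tr (q *m S).
  rewrite qE -FihF !mulmxA -(mulmxA _ phi^T) -trmx_mul Jphi trmx_mul !mulmxA.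
  by [].
have tr0 : \tr (J *m (G *m phi'^T) *m J^T *m (invmx h *m F)) = 0.
  rewrite -mxtrace_tr !trmx_mul !trmxK ihT GT Fih -!mulmxA.
  rewrite mulNmx -mulmxA (mulmxA F) -Jphi raddfN /=.
  have := tr_phi'; rewrite /pi.
  rewrite -!mulmxA mxtrace_mulC -!mulmxA mxtrace_mulC -!mulmxA => ->.
  by rewrite oppr0.
rewrite /= mulmxBl raddfB /= trpF trFp opprK mulmxDr 2!mulmxDl mxtraceD trq tr0 addr0.
by move=> pq; rewrite mulr2n mulmxBl mulmxDl raddfB raddfD /= pq subrr.
Qed.

End Trace.

(** * Symmetry of second derivatives *)

Section Young.
Context {R : realType} {V : normedModType R}.
Implicit Types (f : V -> R^o) (x u v : V).

Let second_difference f x u v : R :=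
  f (x + (u + v)) - f (x + u) - f (x + v) + f x.

(** The mean value theorem, applied along u to the difference of f at points
    that differ by t v, expresses the second difference by first derivatives
    near x, and these are controlled by the differential of 'D_u f at x. *)
Lemma second_difference_approx f x u v (e : R) : 0 < e ->
  (\forall y \near x, differentiable f y) ->
  differentiable ('D_u f : V -> R^o) x ->
  \forall t \near 0^'+,
    `| second_difference f x (t *: u) (t *: v) - t ^+ 2 * 'D_v ('D_u f : V -> R^o) x | <=
    t ^+ 2 * e.
Proof.
move=> e0 fd gd.
pose g := 'D_u f : V -> R^o.
(* t C bounds the sum of the norms of the two displacements s u + t v and s u,
   for s between 0 and t. *)
pose C := `|u| + `|u| + `|v| + 1.
have C0 : 0 < C by rewrite /C ltr_wpDl // !addr_ge0.
have /diff_locally /eqaddoP := gd.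
move=> /(_ (e / C)); rewrite divr_gt0 // => /(_ isT) gnear.
have : \forall h \near (0 : V), differentiable f (x + h) /\
  `|g (h + x) - (g x + 'd g x h)| <= e / C * `|h|.
  near=> h; split; last by near: h; exact: gnear.
  near: h.
  have cx : x + h @[h --> (0 : V)] --> x.
    by rewrite -[X in _ --> X]addr0; apply: cvgD; [exact: cvg_cst|exact: cvg_id].
  exact: (cx _ fd).
move=> /nbhs_ballP[d /= d0 dball].
near=> t.
have t0 : 0 < t by near: t; exact: nbhs_right_gt.
have tC : t * C < d.
  rewrite -ltr_pdivlMr //; near: t; apply: nbhs_right_lt; exact: divr_gt0.
have small s (w : V) : 0 <= s <= t -> w = 0 \/ w = t *: v ->
  `|s *: u + w| <= t * (`|u| + `|v|).
  move=> /andP[s0 st] ww; apply: (le_trans (ler_normD _ _)).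
  rewrite mulrDr lerD //; first by rewrite normrZ ger0_norm // ler_wpM2r.
  by case: ww => ->; rewrite ?normr0 ?mulr_ge0 ?normrZ ?gtr0_norm // ltW.
have inball s w : 0 <= s <= t -> w = 0 \/ w = t *: v ->
    differentiable f (x + (s *: u + w)) /\
    `|g (s *: u + w + x) - (g x + 'd g x (s *: u + w))| <= e / C * `|s *: u + w|.
  move=> st ww; apply: dball; rewrite -ball_normE /= sub0r normrN.
  apply: le_lt_trans tC; apply: le_trans (small s w st ww) _.
  rewrite ler_wpM2l ?ltW // /C.
  by have := normr_ge0 u; lra.
pose F s : R^o := f (x + (s *: u + t *: v)) - f (x + (s *: u + 0)).
have dline s w : 0 <= s <= t -> w = 0 \/ w = t *: v ->
    is_derive s 1 (fun s => f (x + (s *: u + w)) : R^o) (g (s *: u + w + x)).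
  move=> st ww; have [df _] := inball s w st ww.
  pose l (r : R) : V := r *: u + (x + w).
  have lE r : x + (r *: u + w) = l r by rewrite addrCA.
  have dl : differentiable (fun r : R => r *: u) s by exact: differentiableZl.
  have ld : differentiable l s by exact: differentiableD.
  have lu : 'd l s 1 = u.
    rewrite (diffD dl (differentiable_cst (x + w) s)) diff_cst.
    rewrite (diffZl u (@ex_diff _ _ _ _ _ _ _ (is_diff_id s))).
    by rewrite /= addr0 diff_val scale1r.
  rewrite (_ : (fun r => _) = f \o l); last by apply/funext => r /=; rewrite -lE.
  rewrite lE in df.
  have dfl : differentiable (f \o l) s by exact: differentiable_comp.
  apply: DeriveDef; first exact: diff_derivable.
  rewrite deriveE // diff_comp //= lu -deriveE // -lE addrC.
  by [].
have dF s : 0 <= s <= t -> is_derive s 1 F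
    (g (s *: u + t *: v + x) - g (s *: u + 0 + x)).
  by move=> st; apply: is_deriveB; apply: dline => //; [right|left].
have [s sI] : exists2 s, s \in `]0, t[ & F t - F 0 =
    (g (s *: u + t *: v + x) - g (s *: u + 0 + x)) * (t - 0).
  apply: MVT => // [s|].
    by rewrite in_itv /= => /andP[s0 st]; apply: dF; rewrite !ltW.
  apply: derivable_within_continuous => s; rewrite in_itv /= => sI.
  by have [] := dF s sI.
have st : 0 <= s <= t by move: sI; rewrite in_itv /= => /andP[s0 st]; rewrite !ltW.
have -> : F t - F 0 = second_difference f x (t *: u) (t *: v).
  by rewrite /F /second_difference scale0r !add0r !addr0 opprD opprK addrA.
have [_ g1] := inball s (t *: v) st (or_intror erefl).
have [_ g2] := inball s 0 st (or_introl erefl).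
rewrite subr0 => ->.
have -> : 'D_v g x = 'd g x v by rewrite deriveE.
have Luv : 'd g x (s *: u + t *: v) = s * 'd g x u + t * 'd g x v :> R.
  by rewrite linearD !linearZ.
have Lu : 'd g x (s *: u + 0) = s * 'd g x u :> R by rewrite addr0 linearZ.
move: g1 g2; rewrite Luv Lu; move: (g _) (g (s *: u + 0 + x)) (g x) => d1 d2 gx.
move: ('d g x u : R) ('d g x v : R) => Du Dv g1 g2.
have -> : (d1 - d2) * t - t ^+ 2 * Dv =
   t * ((d1 - (gx + (s * Du + t * Dv))) - (d2 - (gx + s * Du))) :> R.
  by ring.
rewrite normrM gtr0_norm // exprS expr1 -mulrA ler_pM2l //.
apply: le_trans (ler_normB _ _) _.
apply: le_trans (lerD g1 g2) _.
rewrite -mulrDr.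
have s1 := small s (t *: v) st (or_intror erefl).
have s2 : `|s *: u + 0| <= t * `|u|.
  by rewrite addr0 normrZ ger0_norm ?ler_wpM2r //; case/andP: st.
apply: (@le_trans _ _ (e / C * (t * C))).
  rewrite ler_pM2l ?divr_gt0 //; apply: le_trans (lerD s1 s2) _.
  by rewrite -mulrDr ler_pM2l // /C addrAC lerDl.
by rewrite mulrCA divfK ?gt_eqF // mulrC.
Unshelve. all: by end_near. Qed.

(** Young's theorem: the second difference is symmetric in u and v and
    approximates t^2 times either mixed derivative up to o(t^2), so continuity
    of the second derivatives is not at stake. *)
Lemma derive_swap f x u v :
  (\forall y \near x, differentiable f y) ->
  differentiable ('D_u f : V -> R^o) x ->
  differentiable ('D_v f : V -> R^o) x ->
  'D_v ('D_u f : V -> R^o) x = 'D_u ('D_v f : V -> R^o) x.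
Proof.
move=> fd du dv; apply/eqP; rewrite -subr_eq0 -normr_le0; apply/ler_addgt0Pl => e e0.
have e2 : 0 < e / 2 by exact: divr_gt0.
have near1 := second_difference_approx v e2 fd du.
have near2 := second_difference_approx u e2 fd dv.
have [t [[h1 h2] t0]] := filter_ex (filterI (filterI near1 near2) (nbhs_right_gt (0 : R))).
have sdC : second_difference f x (t *: v) (t *: u) =
           second_difference f x (t *: u) (t *: v).
  by rewrite /second_difference (addrC (t *: v)) (addrAC (f _)).
rewrite addr0 -(@ler_pM2l _ (t ^+ 2)) ?exprn_gt0 //.
have tt : `|t ^+ 2| = t ^+ 2 by rewrite ger0_norm // exprn_ge0 // ltW.
rewrite -{1}tt -normrM mulrBr.
move: h1 h2; rewrite sdC; set d := second_difference _ _ _ _; move=> h1 h2.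
have -> : forall a b : R, a - b = (d - b) - (d - a) by move=> a b; ring.
apply: le_trans (ler_normB _ _) _; apply: le_trans (lerD h2 h1) _.
by rewrite -mulrDr -splitr.
Unshelve. all: by end_near. Qed.

End Young.

(** * Calculus of matrix-valued functions *)

Section MatrixCalculus.
Context {R : realType} {V : normedModType R}.
Implicit Types (x v : V).

Lemma derive_entry {m n} (A : V -> 'M[R]_(m, n)) x v i j : derivable A x v ->
  'D_v A x i j = 'D_v (fun y => A y i j : R^o) x.
Proof. by move=> dA; rewrite derive_mx // mxE. Qed.

Lemma derivable_entry {m n} (A : V -> 'M[R]_(m, n)) x v i j : derivable A x v ->
  derivable (fun y => A y i j : R^o) x v.
Proof. by move=> /derivable_mxP. Qed.

Lemma is_derive_mx {m n} (A : V -> 'M[R]_(m, n)) x v (B : 'M[R]_(m, n)) :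
  (forall i j, is_derive x v (fun y => A y i j : R^o) (B i j)) ->
  is_derive x v A B.
Proof.
move=> AB; have dA : derivable A x v by apply/derivable_mxP => i j; case: (AB i j).
apply: DeriveDef => //; apply/matrixP => i j; rewrite derive_entry //.
by case: (AB i j).
Qed.

Lemma is_derive_mulmx {m n p} (A : V -> 'M[R]_(m, n)) (B : V -> 'M[R]_(n, p)) x v :
  derivable A x v -> derivable B x v ->
  is_derive x v (fun y => A y *m B y) ('D_v A x *m B x + A x *m 'D_v B x).
Proof.
move=> dA dB; apply: is_derive_mx => i k.
have -> : (fun y => (A y *m B y) i k) =
   \sum_j (fun y => A y i j : R^o) * (fun y => B y j k : R^o).
  by apply/funext => y; rewrite mxE fct_sumE.
rewrite !mxE -big_split /=.
apply: is_derive_sum => j.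
have dAj := derivableP ((derivable_mxP _ _ _).1 dA i j).
have dBj := derivableP ((derivable_mxP _ _ _).1 dB j k).
apply: is_derive_eq (is_deriveM dAj dBj) _.
by rewrite !derive_entry // addrC; congr (_ + _); rewrite mulrC.
Qed.

Lemma derivable_mulmx {m n p} (A : V -> 'M[R]_(m, n)) (B : V -> 'M[R]_(n, p)) x v :
  derivable A x v -> derivable B x v -> derivable (fun y => A y *m B y) x v.
Proof. by move=> dA dB; have [] := is_derive_mulmx dA dB. Qed.

Lemma is_derive_trmx {m n} (A : V -> 'M[R]_(m, n)) x v : derivable A x v ->
  is_derive x v (fun y => (A y)^T) ('D_v A x)^T.
Proof.
move=> dA; apply: is_derive_mx => i j; rewrite mxE derive_entry //.
under eq_fun do rewrite mxE.
exact/derivableP/derivable_entry.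
Qed.

Lemma derivable_prodr {I : Type} (s : seq I) (F : I -> V -> R^o) x v :
  (forall i, derivable (F i) x v) -> derivable (fun y => \prod_(i <- s) F i y : R^o) x v.
Proof.
move=> dF; elim: s => [|i s IHs].
  by under eq_fun do rewrite big_nil; exact: derivable_cst.
under eq_fun do rewrite big_cons.
exact: (derivableM (dF i) IHs).
Qed.

Lemma derivable_sumr {I : Type} (s : seq I) (F : I -> V -> R^o) x v :
  (forall i, derivable (F i) x v) -> derivable (fun y => \sum_(i <- s) F i y : R^o) x v.
Proof.
move=> dF; elim: s => [|i s IHs].
  by under eq_fun do rewrite big_nil; exact: derivable_cst.
under eq_fun do rewrite big_cons.
exact: (derivableD (dF i) IHs).
Qed.

Lemma derivable_det {n} (A : V -> 'M[R]_n) x v : derivable A x v ->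
  derivable (fun y => \det (A y) : R^o) x v.
Proof.
move=> dA; rewrite /determinant; apply: derivable_sumr => s.
apply: derivableM; first exact: derivable_cst.
by apply: derivable_prodr => i; exact: derivable_entry.
Qed.

Lemma derivable_adj {n} (A : V -> 'M[R]_n) x v : derivable A x v ->
  derivable (fun y => \adj (A y)) x v.
Proof.
move=> dA; apply/derivable_mxP => i j.
under eq_fun do rewrite mxE.
apply: derivableM; first exact: derivable_cst.
apply: derivable_det; apply/derivable_mxP => k l.
under eq_fun do rewrite !mxE.
exact: derivable_entry.
Qed.

(** The coefficients of Y z on the rows of J z vary with z, but their derivative
    could contribute only a multiple of J y *m w = 0.  Instead of differentiating them,
    one multiplies by the determinant of J z K, where K is a right inverse of
    J y: then they are given by an adjugate, hence derivable. *)
Lemma derive_tangent {m n q} (J : V -> 'M[R]_(m, n)) (Y : V -> 'M[R]_(q, n)) y v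
    (F : 'M[R]_(q, m)) p (w : 'M[R]_(n, p)) :
  derivable J y v -> derivable Y y v -> row_free (J y) ->
  (\forall z \near y, (Y z <= J z)%MS) ->
  Y y = F *m J y -> J y *m w = 0 ->
  'D_v Y y *m w = F *m 'D_v J y *m w.
Proof.
move=> dJ dY Jfree YJ YF Jw.
pose K := pinvmx (J y); pose C z := J z *m K.
have JK : J y *m K = 1%:M by exact: mulmxVp.
have dcst r s (B : 'M[R]_(r, s)) : derivable (fun _ : V => B) y v by exact: derivable_cst.
have dC : derivable C y v := derivable_mulmx dJ (dcst _ _ K).
have dYKC := derivable_mulmx (derivable_mulmx dY (dcst _ _ K)) (derivable_adj dC).
have dR := is_derive_mulmx dYKC dJ.
have ddet : derivable (fun z => (\det (C z))%:M : 'M[R]_q) y v.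
  apply/derivable_mxP => i j; under eq_fun do rewrite mxE.
  by case: (i == j); [exact: derivable_det|exact: derivable_cst].
have dL := is_derive_mulmx ddet dY.
have LR : \forall z \near y,
    (\det (C z))%:M *m Y z = Y z *m K *m \adj (C z) *m J z.
  near=> z; have /submxP[B ->] : (Y z <= J z)%MS by near: z.
  rewrite -[B *m J z *m K]mulmxA -/(C z) -[B *m C z *m _]mulmxA mul_mx_adj.
  by rewrite mul_mx_scalar mul_scalar_mx scalemxAl.
have := near_eq_derive v LR; rewrite (derive_val (is_derive := dL)).
rewrite (derive_val (is_derive := dR)) => /(congr1 (mulmxr w)) /=.
have Cy : C y = 1%:M by [].
have adj1 : \adj (1%:M : 'M[R]_m) = 1%:M.
  by rewrite -[LHS]mul1mx mul_mx_adj det1.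
rewrite YF Cy det1 mul1mx adj1 mulmx1 -[F *m J y *m K]mulmxA JK mulmx1.
by rewrite !mulmxDl -!mulmxA Jw !mulmx0 !add0r.
Unshelve. all: by end_near. Qed.

Lemma near_eq_differentiable {W : normedModType R} (f g : V -> W) x :
  (\forall y \near x, f y = g y) -> differentiable f x -> differentiable g x.
Proof.
move=> fg df; have cdf := diff_continuous df.
have fgx : f x = g x by exact: nbhs_singleton fg.
have gE : g \o shift x = cst (g x) + 'd f x +o_ 0 id.
  have /eqaddoP fE := diff_locally df; apply/eqaddoP => e e0.
  have cx : h + x @[h --> (0 : V)] --> x.
    by rewrite -[X in _ --> X]add0r; apply: cvgD; [exact: cvg_id|exact: cvg_cst].
  have fgs : \forall h \near 0, f (h + x) = g (h + x) by exact: (cx _ fg).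
  apply: filterS2 fgs (fE e e0) => h fgh.
  by rewrite !fctE /= -fgx -fgh.
apply/diff_locallyP.
by rewrite (diff_unique cdf gE).
Qed.

Lemma differentiable_mx {m n} (A : V -> 'M[R]_(m, n)) x :
  (forall i j, differentiable (fun y => A y i j : R^o) x) -> differentiable A x.
Proof.
move=> dA.
have -> : A = \sum_(i < m) \sum_(j < n) (fun y => A y i j *: delta_mx i j).
  apply/funext => y; rewrite fct_sumE [LHS]matrix_sum_delta.
  by apply: eq_bigr => i _; rewrite fct_sumE.
apply: differentiable_sum => i; apply: differentiable_sum => j.
exact: differentiableZl.
Qed.

End MatrixCalculus.

(** * Smooth maps between coordinate spaces *)

Section SmoothOn.
Context {R : realType} {n p q : nat} (U : set 'rV[R]_n) (F : 'rV[R]_n -> 'M[R]_(p, q)).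
Context (Fsmooth : smooth_on U F).

Lemma smooth_on_differentiable x : U x -> differentiable F x.
Proof.
by move=> Ux; apply: differentiable_mx => i j; have [dF _] := Fsmooth i j 1; exact: dF.
Qed.

Lemma smooth_on_derive x v : open U -> U x ->
  differentiable (fun y => 'D_v F y) x.
Proof.
move=> oU Ux; apply: differentiable_mx => i j.
apply: (@near_eq_differentiable _ _ _ (\sum_(l < n)
  (v 0 l *: (fun y => 'D_(delta_mx 0 l) (fun y => F y i j : R^o) y : R^o)))); last first.
  apply: differentiable_sum => l; apply: differentiableZ.
  by have [_ /(_ l) [dF _]] := Fsmooth i j 2; exact: dF.
have := open_nbhs_nbhs (conj oU Ux); apply: filterS => y Uy.
have dF := smooth_on_differentiable Uy.
have dFij : differentiable (fun y => F y i j : R^o) y.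
  by have [dFij _] := Fsmooth i j 1; exact: dFij.
rewrite derive_entry; last exact: diff_derivable.
rewrite fct_sumE; transitivity ('d (fun y => F y i j : R^o) y v : R).
  rewrite [X in 'd _ _ X]row_sum_delta linear_sum; apply: eq_bigr => l _.
  by rewrite linearZ -deriveE.
by rewrite -deriveE.
Qed.

Lemma smooth_on_derive_swap x u v : open U -> U x ->
  'D_u (fun y => 'D_v F y) x = 'D_v (fun y => 'D_u F y) x.
Proof.
move=> oU Ux.
have Unear := open_nbhs_nbhs (conj oU Ux).
have entryE w i j : \forall y \near x, 'D_w F y i j = 'D_w (fun y => F y i j : R^o) y.
  apply: filterS Unear => y Uy; rewrite derive_entry //.
  exact/diff_derivable/smooth_on_differentiable.
have dentry w i j :
    differentiable (fun z => 'D_w (fun y => F y i j : R^o) z : R^o) x.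
  apply: (near_eq_differentiable (entryE w i j)).
  exact: (differentiable_comp (smooth_on_derive w oU Ux) (differentiable_coord _ i j)).
have dDF w w' : derivable (fun y => 'D_w F y) x w'.
  by apply: diff_derivable; exact: smooth_on_derive.
apply/matrixP => i j.
rewrite [LHS](derive_entry i j (dDF v u)) [RHS](derive_entry i j (dDF u v)).
rewrite [LHS](near_eq_derive _ (entryE v i j)) [RHS](near_eq_derive _ (entryE u i j)).
apply: derive_swap => //; apply: filterS Unear => y Uy.
by have [dF _] := Fsmooth i j 1; exact: dF.
Qed.

End SmoothOn.

(** * Exterior derivatives *)

Lemma mx_bilinear_eq {R : pzRingType} {m n} (A B : 'M[R]_(m, n)) :
  (forall (u : 'rV_m) (v : 'rV_n), (u *m A *m v^T) 0 0 = (u *m B *m v^T) 0 0) -> A = B.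
Proof.
move=> AB; apply/matrixP => i j.
have ent (C : 'M[R]_(m, n)) :
    ((delta_mx 0 i : 'rV_m) *m C *m (delta_mx 0 j : 'rV_n)^T) 0 0 = C i j.
  by rewrite trmx_delta -colE -rowE !mxE.
by rewrite -ent AB ent.
Qed.

Lemma derive_mulmxl {R : realType} {V : normedModType R} {m n p}
    (B : 'M[R]_(m, n)) (A : V -> 'M[R]_(n, p)) x v :
  derivable A x v -> 'D_v (fun y => B *m A y) x = B *m 'D_v A x.
Proof.
move=> dA; have dB : derivable (fun _ : V => B) x v by exact: derivable_cst.
rewrite (derive_val (is_derive := is_derive_mulmx dB dA)).
by rewrite derive_cst mul0mx add0r.
Qed.

Lemma derive_mulmxr {R : realType} {V : normedModType R} {m n p}
    (A : V -> 'M[R]_(m, n)) (B : 'M[R]_(n, p)) x v :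
  derivable A x v -> 'D_v (fun y => A y *m B) x = 'D_v A x *m B.
Proof.
move=> dA; have dB : derivable (fun _ : V => B) x v by exact: derivable_cst.
rewrite (derive_val (is_derive := is_derive_mulmx dA dB)).
by rewrite derive_cst mulmx0 addr0.
Qed.

Section OneForm.
Context {R : realType} {n : nat} {M : manifold R n} (a : one_form M).
Context (c : chart R n M) (Ac : atlas c).
Let U := cmap c @` cdom c.
Let oU : open U. Proof. exact: cimg_open. Qed.

Lemma ext_dE x u v : U x ->
  ext_d a c x u v = 2^-1 * ((v *m 'D_u (a c) x) 0 0 - (u *m 'D_v (a c) x) 0 0).
Proof.
move=> Ux; have da w : derivable (a c) x w.
  by apply: diff_derivable; exact: (smooth_on_differentiable (of_smooth a Ac) Ux).
have dwa w w' : derivable (fun y => w *m a c y) x w'.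
  exact: derivable_mulmx (derivable_cst _ _ _) (da w').
rewrite /ext_d /form_eval.
by rewrite -!derive_mulmxl // !derive_entry.
Qed.

Lemma ext_dC x u v : ext_d a c x v u = - ext_d a c x u v.
Proof. by rewrite /ext_d -mulrN opprB. Qed.

Lemma is_derive_ext_d x u v w : U x ->
  is_derive x w (fun y => ext_d a c y u v : R^o)
   (2^-1 * ((v *m 'D_w (fun y => 'D_u (a c) y) x) 0 0 -
            (u *m 'D_w (fun y => 'D_v (a c) y) x) 0 0)).
Proof.
move=> Ux; pose S y := 2^-1 *: (v *m 'D_u (a c) y - u *m 'D_v (a c) y).
have dDa w1 : derivable (fun y => 'D_w1 (a c) y) x w.
  by apply: diff_derivable; exact: (smooth_on_derive (of_smooth a Ac) w1 oU Ux).
have dwDa (w2 w1 : 'rV[R]_n) : derivable (fun y => w2 *m 'D_w1 (a c) y) x w.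
  exact: derivable_mulmx (derivable_cst _ _ _) (dDa w1).
have dB := derivableB (dwDa v u) (dwDa u v).
have dS : derivable S x w by exact: (derivableZ dB).
apply: (@near_eq_is_derive _ _ _ (fun y => S y 0 0 : R^o)).
  apply: filterS (open_nbhs_nbhs (conj oU Ux)) => y Uy.
  by rewrite ext_dE // !mxE.
apply: DeriveDef; first exact: ((derivable_mxP _ _ _).1 dS 0 0).
have SE : 'D_w S x = 2^-1 *: (v *m 'D_w (fun y => 'D_u (a c) y) x -
                              u *m 'D_w (fun y => 'D_v (a c) y) x).
  apply: etrans (deriveZ _ dB) _; congr (_ *: _).
  by apply: etrans (deriveB (dwDa v u) (dwDa u v)) _; rewrite !derive_mulmxl.
apply: etrans (esym (derive_entry 0 0 dS)) _.
have ent (A B : 'M[R]_1) : (2^-1 *: (A - B)) 0 0 = 2^-1 * (A 0 0 - B 0 0).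
  by rewrite !mxE.
by rewrite -ent -SE.
Qed.

(** Fields with constant components commute, so this is d(da) = 0; it comes down
    to the symmetry of the second derivatives of a. *)
Lemma ext_d_closed x u v w : U x ->
  'D_u (fun y => ext_d a c y v w : R^o) x + 'D_v (fun y => ext_d a c y w u : R^o) x +
  'D_w (fun y => ext_d a c y u v : R^o) x = 0.
Proof.
move=> Ux; pose D u1 v1 := 'D_u1 (fun y => 'D_v1 (a c) y) x.
have DC u1 v1 : D u1 v1 = D v1 u1.
  exact: (smooth_on_derive_swap (of_smooth a Ac) u1 v1 oU Ux).
have DE u1 v1 w1 : 'D_w1 (fun y => ext_d a c y u1 v1 : R^o) x =
    2^-1 * ((v1 *m D w1 u1) 0 0 - (u1 *m D w1 v1) 0 0).
  exact: (derive_val (is_derive := is_derive_ext_d u1 v1 w1 Ux)).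
rewrite !DE; move: D DC {DE} => D DC; rewrite (DC v u) (DC w u) (DC w v).
by ring.
Qed.

End OneForm.

(** * Derivatives of the structure tensors in a chart *)

Section ReebDerivatives.
Context {R : realType} {n : nat} {M : manifold R n}.
Context (g : riemannian_metric M) (a : one_form M) (Z : vector_field M).
Context (c : chart R n M) (Ac : atlas c).
Let U := cmap c @` cdom c.
Context (g_Z : forall x, U x -> g c x *m (Z c x)^T = a c x).
Context (Z_a : forall x, U x -> Z c x *m a c x = 1%:M).
Context (da_Z : forall x v, U x -> ext_d a c x (Z c x) v = 0).
Context (x : 'rV[R]_n) (Ux : U x).
Let oU : open U. Proof. exact: cimg_open. Qed.
Let nearU : nbhs x U := open_nbhs_nbhs (conj oU Ux).

Let dg v : derivable (g c) x v.
Proof. by apply: diff_derivable; exact: (smooth_on_differentiable (rm_smooth g Ac) Ux). Qed.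
Let da v : derivable (a c) x v.
Proof. by apply: diff_derivable; exact: (smooth_on_differentiable (of_smooth a Ac) Ux). Qed.
Let dZ v : derivable (Z c) x v.
Proof. by apply: diff_derivable; exact: (smooth_on_differentiable (vf_smooth Z Ac) Ux). Qed.

Lemma derive_reeb_normalized v :
  'D_v (Z c) x *m a c x + Z c x *m 'D_v (a c) x = 0.
Proof.
rewrite -(derive_val (is_derive := is_derive_mulmx (@dZ v) (@da v))).
rewrite (@near_eq_derive _ _ _ _ (cst 1%:M)); last exact: filterS nearU.
exact: derive_cst.
Qed.

(** The derivative of g(Z, .) = a; the symmetry of g puts it in row form. *)
Lemma derive_reeb_dual v :
  'D_v (Z c) x *m g c x + Z c x *m 'D_v (g c) x = ('D_v (a c) x)^T.
Proof.
rewrite -(derive_val (is_derive := is_derive_mulmx (@dZ v) (@dg v))).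
rewrite -(derive_val (is_derive := is_derive_trmx (@da v))).
apply: near_eq_derive; apply: filterS nearU => y Uy.
by rewrite -g_Z // trmx_mul trmxK rm_sym.
Qed.

Lemma derive_metric_reeb v :
  Z c x *m 'D_v (g c) x *m (Z c x)^T = (Z c x *m 'D_v (a c) x) *+ 2.
Proof.
have := congr1 (mulmxr (Z c x)^T) (derive_reeb_dual v).
rewrite /= mulmxDl -[_ *m g c x *m _]mulmxA g_Z // -trmx_mul trmx11.
have /eqP := derive_reeb_normalized v; rewrite addr_eq0 => /eqP -> /eqP.
by rewrite addrC subr_eq -mulr2n => /eqP.
Qed.

(** The equation da(Z, v) = 0 for a constant v; it says that Z has geodesic
    integral curves. *)
Lemma derive_along_reeb v :
  (v *m 'D_(Z c x) (a c) x) 0 0 = (Z c x *m 'D_v (a c) x) 0 0.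
Proof.
have half0 (A B : R) : 2^-1 * (A - B) = 0 -> A = B.
  by move/eqP; rewrite mulf_eq0 invr_eq0 pnatr_eq0 /= subr_eq0 => /eqP.
exact: (half0 _ _ (etrans (esym (ext_dE a Ac (Z c x) v Ux)) (da_Z v Ux))).
Qed.

End ReebDerivatives.

Section AmbientDerivatives.
Context {R : realType} {n h k : nat} {M : manifold R n}.
Context {a1 a2 : one_form M} {Z1 Z2 : vector_field M} {phi : endo_field M}.
Context {g : riemannian_metric M} (mcp : metric_contact_pair h k a1 a2 Z1 Z2 phi g).
Context (c : chart R n M) (Ac : atlas c).
Let U := cmap c @` cdom c.
Let oU : open U. Proof. exact: cimg_open. Qed.

Lemma fundamental_form x u v : U x ->
  (u *m (g c x *m (phi c x)^T) *m v^T) 0 0 = ext_d a1 c x u v + ext_d a2 c x u v.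
Proof.
move=> Ux; rewrite -(mcp_phi mcp (conj Ac Ux)) /metric_eval trmx_mul.
by rewrite !mulmxA.
Qed.

(** In matrix form: g(X, phi Y) is a 2-form. *)
Lemma phi_skew x : U x -> phi c x *m g c x = - (g c x *m (phi c x)^T).
Proof.
move=> Ux; apply: mx_bilinear_eq => u v.
rewrite mulmxN mulNmx [RHS]mxE fundamental_form //.
rewrite ext_dC [X in _ + X]ext_dC -opprD opprK -fundamental_form //.
have tr (A : 'M[R]_1) : A 0 0 = A^T 0 0 by rewrite mxE.
rewrite [RHS]tr !trmx_mul !trmxK (rm_sym g (conj Ac Ux)) !mulmxA.
by [].
Qed.

Lemma metric_reeb1 x : U x -> g c x *m (Z1 c x)^T = a1 c x.
Proof.
move=> Ux; apply: mx_bilinear_eq => u v.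
have := mcp_Z1 mcp (conj Ac Ux) u; rewrite /metric_eval /form_eval mulmxA.
rewrite [v^T]mx11_scalar !mul_mx_scalar => e.
by rewrite [LHS]mxE e [RHS]mxE.
Qed.

Lemma metric_reeb2 x : U x -> g c x *m (Z2 c x)^T = a2 c x.
Proof.
move=> Ux; apply: mx_bilinear_eq => u v.
have := mcp_Z2 mcp (conj Ac Ux) u; rewrite /metric_eval /form_eval mulmxA.
rewrite [v^T]mx11_scalar !mul_mx_scalar => e.
by rewrite [LHS]mxE e [RHS]mxE.
Qed.

Context (x : 'rV[R]_n) (Ux : U x).
Let nearU : nbhs x U := open_nbhs_nbhs (conj oU Ux).
Let dg v : derivable (g c) x v.
Proof. by apply: diff_derivable; exact: (smooth_on_differentiable (rm_smooth g Ac) Ux). Qed.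
Let dphi v : derivable (phi c) x v.
Proof. by apply: diff_derivable; exact: (smooth_on_differentiable (ef_smooth phi Ac) Ux). Qed.
Let da (a : one_form M) v : derivable (a c) x v.
Proof. by apply: diff_derivable; exact: (smooth_on_differentiable (of_smooth a Ac) Ux). Qed.
Let dZ (Z : vector_field M) v : derivable (Z c) x v.
Proof. by apply: diff_derivable; exact: (smooth_on_differentiable (vf_smooth Z Ac) Ux). Qed.
Let dphiT v : derivable (fun y => (phi c y)^T) x v.
Proof. by have [] := is_derive_trmx (@dphi v). Qed.

(** The derivative along v of the matrix of Omega(X, Y) = g(X, phi Y), in the
    form that the product rule gives it. *)
Definition derive_fundamental v : 'M[R]_n :=
  'D_v (g c) x *m (phi c x)^T + g c x *m ('D_v (phi c) x)^T.

Lemma is_derive_fundamental v :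
  is_derive x v (fun y => g c y *m (phi c y)^T) (derive_fundamental v).
Proof.
apply: is_derive_eq (is_derive_mulmx (@dg v) (@dphiT v)) _.
by rewrite (derive_val (is_derive := is_derive_trmx (@dphi v))).
Qed.

Lemma derive_phi_skew v :
  'D_v (phi c) x *m g c x + phi c x *m 'D_v (g c) x = - derive_fundamental v.
Proof.
rewrite -(derive_val (is_derive := is_derive_mulmx (@dphi v) (@dg v))).
have dK := is_derive_fundamental v; rewrite -(derive_val (is_derive := dK)).
rewrite -deriveN; last by case: dK.
apply: near_eq_derive; apply: filterS nearU => y Uy.
exact: phi_skew.
Qed.

Lemma derive_fundamental_skew v : (derive_fundamental v)^T = - derive_fundamental v.
Proof.
rewrite -derive_phi_skew /derive_fundamental linearD /= !trmx_mul !trmxK.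
rewrite (rm_sym g (conj Ac Ux)) addrC; congr (_ + _ *m _).
rewrite -(derive_val (is_derive := is_derive_trmx (@dg v))).
apply: near_eq_derive; apply: filterS nearU => y Uy.
exact: (rm_sym g (conj Ac Uy)).
Qed.

(** Omega is exact by [fundamental_form], so closed. *)
Lemma derive_fundamental_closed u v w :
  (v *m derive_fundamental u *m w^T) 0 0 + (w *m derive_fundamental v *m u^T) 0 0 +
  (u *m derive_fundamental w *m v^T) 0 0 = 0.
Proof.
have E u1 v1 w1 : (v1 *m derive_fundamental u1 *m w1^T) 0 0 =
    'D_u1 (fun y => ext_d a1 c y v1 w1 : R^o) x +
    'D_u1 (fun y => ext_d a2 c y v1 w1 : R^o) x.
  have dK := is_derive_fundamental u1.
  have dK1 : derivable (fun y => g c y *m (phi c y)^T) x u1 by case: dK.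
  have dvK : derivable (fun y => v1 *m (g c y *m (phi c y)^T)) x u1.
    exact: derivable_mulmx (derivable_cst _ _ _) dK1.
  have dvKw : derivable (fun y => v1 *m (g c y *m (phi c y)^T) *m w1^T) x u1.
    exact: derivable_mulmx dvK (derivable_cst _ _ _).
  rewrite -(derive_val (is_derive := dK)) -derive_mulmxl // -derive_mulmxr //.
  apply: etrans (derive_entry 0 0 dvKw) _.
  have de a := is_derive_ext_d a Ac v1 w1 u1 Ux.
  rewrite -deriveD; [|by case: (de a1)|by case: (de a2)].
  apply: near_eq_derive; apply: filterS nearU => y Uy.
  exact: fundamental_form.
have sum6 (p q r p1 q1 r1 p2 q2 r2 : R) : p = p1 + p2 -> q = q1 + q2 -> r = r1 + r2 ->
  p1 + q1 + r1 = 0 -> p2 + q2 + r2 = 0 -> p + q + r = 0 by lra.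
exact: (sum6 _ _ _ _ _ _ _ _ _ (E u v w) (E v w u) (E w u v)
  (ext_d_closed a1 Ac u v w Ux) (ext_d_closed a2 Ac u v w Ux)).
Qed.

Lemma derive_phi_sqr v :
  'D_v (phi c) x *m phi c x + phi c x *m 'D_v (phi c) x =
  'D_v (a1 c) x *m Z1 c x + a1 c x *m 'D_v (Z1 c) x +
  ('D_v (a2 c) x *m Z2 c x + a2 c x *m 'D_v (Z2 c) x).
Proof.
rewrite -(derive_val (is_derive := is_derive_mulmx (@dphi v) (@dphi v))).
have d1 := is_derive_mulmx (@da a1 v) (@dZ Z1 v).
have d2 := is_derive_mulmx (@da a2 v) (@dZ Z2 v).
have d12 := is_deriveD (is_deriveD (is_derive_cst (- 1%:M : 'M[R]_n) x v) d1) d2.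
rewrite (near_eq_derive v (g := cst (- 1%:M) + (fun y => a1 c y *m Z1 c y) +
   (fun y => a2 c y *m Z2 c y))).
  by rewrite (derive_val (is_derive := d12)) add0r.
apply: filterS nearU => y Uy.
exact: (cps_sqr (mcp_structure mcp) (conj Ac Uy)).
Qed.

End AmbientDerivatives.

(** * Immersed submanifolds in charts *)

Section LocalRepresentation.
Context {R : realType} {m n : nat} {L : manifold R m} {M : manifold R n}.
Context (f : L -> M) (f_smooth : smooth_map f).
Context (c : chart R m L) (c' : chart R n M) (Ac : atlas c) (Ac' : atlas c').
Let r := local_rep f c c'.
Let W := local_dom f c c'.

Lemma local_dom_in_chart z : W z -> in_chart c' (r z).
Proof.
move=> [p [cp fp] <-]; split => //.
by exists (f p) => //; rewrite /r /local_rep /= cmapK.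
Qed.

(** The domain is the image under the chart of an open subset of L, so the
    preimage of that subset under the continuous inverse chart. *)
Lemma open_local_dom : open W.
Proof.
pose V := cdom c `&` f @^-1` cdom c'.
have oV : open V.
  apply: openI; first exact: cdom_open.
  by apply: open_comp; [move=> ? _; case: f_smooth => + _; exact|exact: cdom_open].
have cinv_cont := cinv_continuous (c := c).
rewrite continuous_open_subspace in cinv_cont; last exact: cimg_open.
rewrite openE => _ [p Vp <-].
have img_p : (cmap c @` cdom c) (cmap c p) by exists p; case: Vp.
have Vnear : nbhs (cinv c (cmap c p)) V.
  by rewrite cmapK; [exact: open_nbhs_nbhs|case: Vp].
have := cinv_cont (cmap c p); rewrite inE => /(_ img_p) /(_ _ Vnear) => cinvV.
have imgnear := open_nbhs_nbhs (conj (cimg_open (c := c)) img_p).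
apply: (@filterS2 _ _ _ _ _ W _ cinvV imgnear) => z Vz [p' cp' p'z].
exists p' => //; move: Vz; rewrite /= -p'z cmapK //.
Qed.

Let r_smooth : smooth_on W r. Proof. by case: f_smooth => _; apply. Qed.

Lemma differentiable_local_rep z : W z -> differentiable r z.
Proof. exact: (smooth_on_differentiable r_smooth). Qed.

Lemma row_jacobian z b : W z -> row b ('J r z) = 'D_(delta_mx 0 b) r z.
Proof.
by move=> Wz; rewrite deriveEjacobian ?rowE //; exact: differentiable_local_rep.
Qed.

Lemma derivable_jacobian y v : W y -> derivable (fun z => 'J r z) y v.
Proof.
move=> Wy; apply/derivable_mxP => b i.
have dD := smooth_on_derive r_smooth (delta_mx 0 b) open_local_dom Wy.
have := (derivable_mxP _ _ _).1 (diff_derivable (v := v) dD) 0 i.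
apply: near_eq_derivable; apply: filterS (open_nbhs_nbhs (conj open_local_dom Wy)) => z Wz.
by rewrite -row_jacobian // mxE.
Qed.

Lemma row_derive_jacobian y v b : W y ->
  row b ('D_v (fun z => 'J r z) y) = 'D_v (fun z => 'D_(delta_mx 0 b) r z) y.
Proof.
move=> Wy; have dJ := @derivable_jacobian y v Wy.
rewrite rowE -derive_mulmxl //; apply: near_eq_derive.
apply: filterS (open_nbhs_nbhs (conj open_local_dom Wy)) => z Wz.
by rewrite -rowE row_jacobian.
Qed.

(** The coordinate fields commute: [row b] of the derivative in the direction
    a is a second derivative of the local representation. *)
Lemma derive_jacobian_sym y a b : W y ->
  row b ('D_(delta_mx 0 a) (fun z => 'J r z) y) =
  row a ('D_(delta_mx 0 b) (fun z => 'J r z) y).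
Proof.
move=> Wy; rewrite [LHS](row_derive_jacobian _ b Wy) [RHS](row_derive_jacobian _ a Wy).
exact: (smooth_on_derive_swap r_smooth _ _ open_local_dom Wy).
Qed.

Lemma derive_local_rep {p q} (F : 'rV[R]_n -> 'M[R]_(p, q)) y a : W y ->
  differentiable F (r y) ->
  'D_(delta_mx 0 a) (fun z => F (r z)) y = 'D_(row a ('J r y)) F (r y).
Proof.
move=> Wy dF; have dr := differentiable_local_rep Wy.
rewrite deriveE; last exact: (differentiable_comp dr dF).
have dra : 'd r y (delta_mx 0 a) = row a ('J r y) by rewrite row_jacobian // deriveE.
by rewrite (diff_comp dr dF) /= dra deriveE.
Qed.

End LocalRepresentation.

(** * Christoffel symbols *)

(** The Koszul formula for fields with constant components: lowering the index
    of the Christoffel symbols cancels the inverse metric. *)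
Lemma christoffel_vecE {R : realType} {n : nat} {M : manifold R n}
    (g : riemannian_metric M) c x (u v w : 'rV[R]_n) : in_chart c x ->
  (christoffel_vec g c x u v *m g c x *m w^T) 0 0 *+ 2 =
  (v *m 'D_u (g c) x *m w^T) 0 0 + (u *m 'D_v (g c) x *m w^T) 0 0 -
  (u *m 'D_w (g c) x *m v^T) 0 0.
Proof.
move=> Cx; have [Ac Ux] := Cx.
have dg : differentiable (g c) x := smooth_on_differentiable (rm_smooth g Ac) Ux.
pose T := metric_partial g c x.
have DgE s j l : 'D_s (g c) x j l = \sum_i s 0 i * T i j l.
  rewrite deriveE // {1}[s]row_sum_delta linear_sum summxE; apply: eq_bigr => i _.
  rewrite linearZ mxE -deriveE //; congr (_ * _).
  by apply: derive_entry; exact: diff_derivable.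
have formE (s t z : 'rV[R]_n) : (s *m 'D_t (g c) x *m z^T) 0 0 =
    \sum_l \sum_j \sum_i t 0 i * s 0 j * z 0 l * T i j l.
  rewrite mxE; apply: eq_bigr => l _; rewrite mxE mulr_suml; apply: eq_bigr => j _.
  rewrite DgE mulr_sumr mulr_suml; apply: eq_bigr => i _.
  by rewrite [z^T _ _]mxE; ring.
pose K := \row_l \sum_i \sum_j (T i j l + T j i l - T l i j) * u 0 i * v 0 j.
have -> : christoffel_vec g c x u v = 2^-1 *: (K *m (invmx (g c x))^T).
  apply/rowP => i0; rewrite !mxE.
  transitivity (\sum_i \sum_j \sum_l 2^-1 * ((T i j l + T j i l - T l i j) *
      u 0 i * v 0 j * invmx (g c x) i0 l)).
    apply: eq_bigr => i _; apply: eq_bigr => j _; rewrite /christoffel.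
    rewrite -/T -!mulrA mulr_suml mulr_sumr; apply: eq_bigr => l _.
    by rewrite /T; ring.
  rewrite mulr_sumr; under [RHS]eq_bigr => l _.
    rewrite mxE mulr_suml mulr_sumr.
    under eq_bigr => i _ do rewrite mulr_suml mulr_sumr.
    over.
  rewrite [RHS]exchange_big; apply: eq_bigr => i _ /=.
  rewrite exchange_big; apply: eq_bigr => j _ /=.
  by apply: eq_bigr => l _; rewrite mxE.
rewrite trmx_inv (rm_sym g Cx) -!scalemxAl mulmxKV; last exact: posdef_unit (rm_pos g Cx).
have half (z : R) : (2^-1 * z) *+ 2 = z by rewrite -mulr_natl mulrA mulfV ?mul1r ?pnatr_eq0.
rewrite [X in X *+ 2]mxE half.
rewrite [X in _ = X + _ - _](formE v u w) [X in _ = _ + X - _](formE u v w).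
rewrite [X in _ = _ - X](formE u w v).
have rev (F : 'I_n -> 'I_n -> 'I_n -> R) :
    \sum_l \sum_j \sum_i F i j l = \sum_i \sum_j \sum_l F i j l.
  rewrite exchange_big; under eq_bigr => j _ do rewrite exchange_big.
  by rewrite exchange_big.
rewrite [X in _ = X + _ - _]rev [X in _ = _ + X - _]rev [X in _ = _ + X - _]exchange_big.
rewrite [X in _ = _ - X]exchange_big /= mxE.
under [LHS]eq_bigr => l _.
  rewrite /K mxE mulr_suml; under eq_bigr => i _ do rewrite mulr_suml.
  over.
rewrite [LHS]exchange_big -big_split -sumrB /=; apply: eq_bigr => i _.
rewrite [LHS]exchange_big -big_split -sumrB /=; apply: eq_bigr => j _.
rewrite -big_split -sumrB /=; apply: eq_bigr => l _.
by rewrite mxE; ring.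
Qed.

(** * Phi-invariant submanifolds tangent to the Reeb fields *)

Section InvariantSubmanifold.
Context {R : realType} {n h k m : nat} {M : manifold R n} {L : manifold R m}.
Context {a1 a2 : one_form M} {Z1 Z2 : vector_field M} {phi : endo_field M}.
Context {g : riemannian_metric M} (mcp : metric_contact_pair h k a1 a2 Z1 Z2 phi g).
Context (f : L -> M) (f_imm : immersion f).
Context (c : chart R m L) (c' : chart R n M) (Ac : atlas c) (Ac' : atlas c').
Let r := local_rep f c c'.
Let W := local_dom f c c'.
Context (phi_tan : forall z, W z -> ('J r z *m phi c' (r z) <= 'J r z)%MS).
Context (Z1_tan : forall z, W z -> (Z1 c' (r z) <= 'J r z)%MS).
Context (Z2_tan : forall z, W z -> (Z2 c' (r z) <= 'J r z)%MS).
Context (y : 'rV[R]_m) (Wy : W y).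
Let x := r y.
Let J := 'J r y.
Let G := g c' x.
Context (N : 'rV[R]_n) (N_normal : N *m G *m J^T = 0).

Let f_smooth : smooth_map f := proj1 f_imm.
Let J_free : row_free J := proj2 f_imm c c' y Ac Ac' Wy.
Let Cx : in_chart c' x := local_dom_in_chart Ac' Wy.
Let Ux : (cmap c' @` cdom c') x := proj2 Cx.
Let nearW : nbhs y W.
Proof. by apply: open_nbhs_nbhs; split=> //; exact: open_local_dom. Qed.

Let e (a : 'I_m) : 'rV[R]_m := delta_mx 0 a.
Let J' a := 'D_(e a) (fun z => 'J r z) y.
Let G' a := 'D_(row a J) (g c') x.

Let dJ v : derivable (fun z => 'J r z) y v.
Proof. exact: (@derivable_jacobian _ _ _ _ _ _ f_smooth _ _ Ac Ac' y v Wy). Qed.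

Let J_w : J *m (G *m N^T) = 0.
Proof.
apply: trmx_inj; rewrite !trmx_mul trmxK trmx0.
by rewrite /G (rm_sym g Cx) N_normal.
Qed.

(** The entries are the derivatives of g(N, X_b) in the direction X_a, for b
    varying; as N is normal at the point, these are linear in the value of X_b
    there, by the next lemma. *)
Definition second_form_col a : 'cV[R]_m := (J' a *m G + J *m G' a) *m N^T.

(** The covector g(N, .) kills the tangent space at the point, so
    [derive_tangent] applies to it. *)
Lemma second_form_tangent q (Y : 'rV[R]_m -> 'M[R]_(q, n)) (B : 'M[R]_(q, m)) a :
  derivable Y y (e a) -> (forall z, W z -> (Y z <= 'J r z)%MS) -> Y y = B *m J ->
  B *m second_form_col a = ('D_(e a) Y y *m G + Y y *m G' a) *m N^T.
Proof.
move=> dY Ytan YB; rewrite /second_form_col YB !mulmxDl mulmxDr; congr (_ + _).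
  rewrite -[RHS]mulmxA (derive_tangent (@dJ (e a)) dY J_free _ YB J_w).
    by rewrite /J' !mulmxA.
  by apply: filterS nearW => z; exact: Ytan.
by rewrite !mulmxA.
Qed.

Let F := J *m phi c' x *m pinvmx J.
Let JF : J *m phi c' x = F *m J.
Proof. by rewrite mulmxKpV // phi_tan. Qed.

Let Kf v := derive_fundamental (phi := phi) (g := g) c' x v.

(** The tangent field phi X_b, for which g(N, phi X_b) = - Omega(X_b, N). *)
Lemma second_form_phi a :
  F *m second_form_col a =
  - ((J' a *m (G *m (phi c' x)^T) + J *m Kf (row a J)) *m N^T).
Proof.
have dphi : differentiable (phi c') x.
  exact: (smooth_on_differentiable (ef_smooth phi Ac') Ux).
have dr : differentiable r y by exact: (differentiable_local_rep f_smooth Ac Ac' Wy).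
have dphir : derivable (fun z => phi c' (r z)) y (e a).
  by apply: diff_derivable; exact: (differentiable_comp dr dphi).
have dY := derivable_mulmx (@dJ (e a)) dphir.
rewrite (second_form_tangent dY phi_tan JF).
rewrite (derive_val (is_derive := is_derive_mulmx (@dJ (e a)) dphir)).
rewrite (derive_local_rep f_smooth Ac Ac' a Wy dphi) -/x -/J -/(J' a).
have sk := phi_skew mcp Ac' Ux; have dsk := derive_phi_skew mcp Ac' Ux (row a J).
rewrite -mulNmx; congr (_ *m _); rewrite mulmxDl -addrA -!mulmxA -mulmxDr.
rewrite (_ : phi c' x *m G = - (G *m (phi c' x)^T)); last exact: sk.
rewrite (_ : _ *m G + phi c' x *m _ = - Kf (row a J)); last exact: dsk.
by rewrite !mulmxN [RHS]opprD.
Qed.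

Lemma second_form_reeb (a : one_form M) (Z : vector_field M) (b : 'rV[R]_m) i :
  (forall z, W z -> (Z c' (r z) <= 'J r z)%MS) -> Z c' x = b *m J ->
  (forall x, (cmap c' @` cdom c') x -> g c' x *m (Z c' x)^T = a c' x) ->
  b *m second_form_col i = ('D_(row i J) (a c') x)^T *m N^T.
Proof.
move=> Ztan Zb ga.
have dZ : differentiable (Z c') x.
  exact: (smooth_on_differentiable (vf_smooth Z Ac') Ux).
have dr : differentiable r y by exact: (differentiable_local_rep f_smooth Ac Ac' Wy).
have dZr : derivable (fun z => Z c' (r z)) y (e i).
  by apply: diff_derivable; exact: (differentiable_comp dr dZ).
rewrite (second_form_tangent dZr Ztan Zb).
rewrite (derive_local_rep f_smooth Ac Ac' i Wy dZ) -/x -/J.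
by rewrite (derive_reeb_dual Ac' ga Ux).
Qed.

Let p : 'M[R]_m := \matrix_(a, b) second_form_col a b 0.
Let q := J *m 'D_N (g c') x *m J^T.
Let hm := J *m G *m J^T.

Let mulp s (B : 'M[R]_(s, m)) a b : (p *m B^T) a b = (B *m second_form_col a) b 0.
Proof.
rewrite !mxE; apply: eq_bigr => l _; rewrite !mxE; exact: mulrC.
Qed.

Let bilinE s t (A : 'M[R]_(s, n)) (X : 'M[R]_n) (B : 'M[R]_(t, n)) a b :
  (A *m X *m B^T) a b = (row a A *m X *m (row b B)^T) 0 0.
Proof.
rewrite !mxE; apply: eq_bigr => l _; rewrite !mxE; congr (_ * _).
by apply: eq_bigr => i _; rewrite !mxE.
Qed.

(** The closedness of Omega on X_a, X_b, N.  The two second derivatives of the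
    local representation that [second_form_phi] produces are equal, so they
    cancel in the difference. *)
Lemma second_form_closed :
  p *m F^T - F *m p^T = J *m derive_fundamental (phi := phi) (g := g) c' x N *m J^T.
Proof.
have FpT : F *m p^T = (p *m F^T)^T by rewrite trmx_mul trmxK.
apply/matrixP => a b; rewrite FpT.
have subE (A : 'M[R]_m) : (A - A^T) a b = A a b - A b a by rewrite !mxE.
have entry i j : (p *m F^T) i j =
    - (row j (J' i) *m (G *m (phi c' x)^T *m N^T)) 0 0 -
    (row j J *m Kf (row i J) *m N^T) 0 0.
  apply: etrans (mulp F i j) _.
  apply: etrans (congr1 (fun X : 'cV[R]_m => X j 0) (second_form_phi i)) _.
  move: (Kf _) (J' i) => X Y.
  have ent (A : 'cV[R]_m) : A j 0 = (row j A) 0 0 by rewrite mxE.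
  rewrite mxE mulmxDl mxE opprD; congr (- _ - _); rewrite ent !row_mul //.
  by rewrite -mulmxA.
have skew : (N *m Kf (row b J) *m (row a J)^T) 0 0 = - (row a J *m Kf (row b J) *m N^T) 0 0.
  have := derive_fundamental_skew mcp Ac' Ux (row b J); rewrite -/(Kf (row b J)).
  move: (Kf _) => X XT.
  have tr (A : 'M[R]_1) : A 0 0 = A^T 0 0 by rewrite mxE.
  rewrite [LHS]tr !trmx_mul !trmxK XT mulmxA mulmxN mulNmx mxE.
  by [].
have sym : row b (J' a) = row a (J' b).
  exact: (derive_jacobian_sym f_smooth Ac Ac' a b Wy).
have cl := derive_fundamental_closed mcp Ac' Ux (row a J) (row b J) N.
have alg (s t l k1 k2 k2' k3 : R) : s = - l - k1 -> t = - l - k2 -> k2' = - k2 ->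
  k1 + k2' + k3 = 0 -> s - t = k3.
  by move=> -> -> -> k0; rewrite -[LHS]addr0 -k0; ring.
apply: etrans (subE _) _; apply: etrans _ (esym (bilinE _ _ _ _ _)).
have eab := entry a b; rewrite sym in eab.
exact: (alg _ _ _ _ _ _ _ eab (entry b a) skew cl).
Qed.

(** Both p(Z, Z) and half of q(Z, Z) come down to derivatives of a: the former
    to that of a(N) along Z, the latter to that of a(Z) along N, where N and Z
    are kept constant.  The difference of these is 2 da(Z, N). *)
Lemma second_form_reeb_vanish (a : one_form M) (Z : vector_field M) (b : 'rV[R]_m) :
  (forall z, W z -> (Z c' (r z) <= 'J r z)%MS) -> Z c' x = b *m J ->
  (forall x, (cmap c' @` cdom c') x -> g c' x *m (Z c' x)^T = a c' x) ->
  (forall x, (cmap c' @` cdom c') x -> Z c' x *m a c' x = 1%:M) ->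
  (forall x v, (cmap c' @` cdom c') x -> ext_d a c' x (Z c' x) v = 0) ->
  (b *m (p *+ 2 - q) *m b^T) 0 0 = 0.
Proof.
move=> Ztan Zb ga za dza.
have da : differentiable (a c') x := smooth_on_differentiable (of_smooth a Ac') Ux.
have bpb : (b *m p *m b^T) 0 0 = (N *m 'D_(Z c' x) (a c') x) 0 0.
  have bp i : (p *m b^T) i 0 = (N *m 'D_(row i J) (a c') x) 0 0.
    rewrite mulp (second_form_reeb _ Ztan Zb ga) -trmx_mul mxE.
    by [].
  have dE : 'D_(Z c' x) (a c') x = \sum_i b 0 i *: 'D_(row i J) (a c') x.
    rewrite deriveE // Zb (mulmx_sum_row b J) linear_sum; apply: eq_bigr => i _.
    by rewrite linearZ deriveE.
  rewrite dE mulmx_sumr summxE -mulmxA mxE; apply: eq_bigr => i _.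
  by rewrite bp -scalemxAr [RHS]mxE.
have bqb : b *m q *m b^T = (Z c' x *m 'D_N (a c') x) *+ 2.
  rewrite -(derive_metric_reeb Ac' ga za Ux N) Zb trmx_mul /q !mulmxA.
  by [].
have NZ := derive_along_reeb Ac' dza Ux N.
have subE (A B : 'M[R]_1) : (A *+ 2 - B *+ 2) 0 0 = (A 0 0 - B 0 0) *+ 2.
  by rewrite !mulr2n !mxE; ring.
have -> : b *m (p *+ 2 - q) *m b^T = (b *m p *m b^T) *+ 2 - b *m q *m b^T.
  by rewrite mulmxBr mulmxBl !mulr2n mulmxDr mulmxDl.
by rewrite bqb subE bpb NZ subrr mul0rn.
Qed.

Lemma second_form_trace : \tr ((p *+ 2 - q) *m invmx hm) = 0.
Proof.
have mcs := mcp_structure mcp; have reeb := cps_reeb mcs.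
have [e1 Z1J] := submxP (Z1_tan Wy).
have [e2 Z2J] := submxP (Z2_tan Wy).
have GT := rm_sym g Cx.
have hunit := posdef_congr_unit (rm_pos g Cx) J_free.
have one (a : one_form M) (Z : vector_field M) x0 :
  form_eval a c' x0 (Z c' x0) = 1 -> Z c' x0 *m a c' x0 = 1%:M.
  by move=> e0; apply/matrixP => i j; rewrite !ord1 [RHS]mxE.
have za1 x0 (Ux0 : (cmap c' @` cdom c') x0) : Z1 c' x0 *m a1 c' x0 = 1%:M.
  exact: one (reeb_11 reeb (conj Ac' Ux0)).
have za2 x0 (Ux0 : (cmap c' @` cdom c') x0) : Z2 c' x0 *m a2 c' x0 = 1%:M.
  exact: one (reeb_22 reeb (conj Ac' Ux0)).
rewrite (trace_identity GT (phi_skew mcp Ac' Ux) JF J_free (cps_sqr mcs Cx) Z1J Z2J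
  (metric_reeb1 mcp Ac' Ux) (metric_reeb2 mcp Ac' Ux) (derive_phi_sqr mcp Ac' Ux N)
  (derive_reeb_normalized Ac' za1 Ux N) (derive_reeb_normalized Ac' za2 Ux N)
  erefl erefl hunit second_form_closed).
have dza1 x0 v (Ux0 : (cmap c' @` cdom c') x0) : ext_d a1 c' x0 (Z1 c' x0) v = 0.
  exact: (reeb_d11 reeb (conj Ac' Ux0)).
have dza2 x0 v (Ux0 : (cmap c' @` cdom c') x0) : ext_d a2 c' x0 (Z2 c' x0) v = 0.
  exact: (reeb_d22 reeb (conj Ac' Ux0)).
have gz1 x0 (Ux0 : (cmap c' @` cdom c') x0) : g c' x0 *m (Z1 c' x0)^T = a1 c' x0.
  exact: (metric_reeb1 mcp Ac' Ux0).
have gz2 x0 (Ux0 : (cmap c' @` cdom c') x0) : g c' x0 *m (Z2 c' x0)^T = a2 c' x0.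
  exact: (metric_reeb2 mcp Ac' Ux0).
rewrite (second_form_reeb_vanish Z1_tan Z1J gz1 za1 dza1).
rewrite (second_form_reeb_vanish Z2_tan Z2J gz2 za2 dza2).
exact: addr0.
Qed.

(** By [christoffel_vecE] and the symmetry of the second derivatives, twice the
    covariant derivative paired with N is p + p^T - q. *)
Lemma cov_deriv_trace :
  \sum_(a < m) \sum_(b < m)
    invmx hm a b * (cov_deriv g f c c' y a b *m G *m N^T) 0 0 = 0.
Proof.
pose S : 'M[R]_m := \matrix_(a, b) (cov_deriv g f c c' y a b *m G *m N^T) 0 0.
have hT : (invmx hm)^T = invmx hm.
  by rewrite trmx_inv /hm !trmx_mul trmxK (rm_sym g Cx) mulmxA.
have SE : S *+ 2 = p + p^T - q.
  apply/matrixP => a b.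
  have covE : cov_deriv g f c c' y a b =
      row b (J' a) + christoffel_vec g c' x (row a J) (row b J).
    rewrite /cov_deriv /J' (row_derive_jacobian f_smooth Ac Ac' _ _ Wy).
    rewrite (row_jacobian f_smooth Ac Ac' a Wy) (row_jacobian f_smooth Ac Ac' b Wy).
    by [].
  have colE i j : second_form_col i j 0 =
      (row j (J' i) *m G *m N^T) 0 0 + (row j J *m G' i *m N^T) 0 0.
    have ent (A : 'cV[R]_m) : A j 0 = (row j A) 0 0 by rewrite mxE.
    by rewrite /second_form_col mulmxDl mxE; congr (_ + _); rewrite ent !row_mul.
  have pE i j : p i j = second_form_col i j 0 by rewrite mxE.
  have sym : row a (J' b) = row b (J' a).
    exact: (derive_jacobian_sym f_smooth Ac Ac' b a Wy).
  have chr := christoffel_vecE g (row a J) (row b J) N Cx.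
  have RE : (p + p^T - q) a b = p a b + p b a - q a b by rewrite !mxE.
  have sE : S a b = (row b (J' a) *m G *m N^T) 0 0 +
     (christoffel_vec g c' x (row a J) (row b J) *m G *m N^T) 0 0.
    by rewrite [LHS]mxE covE !mulmxDl mxE.
  have pba := etrans (pE b a) (colE b a); rewrite sym in pba.
  have alg (s A C Ca Cb Q P P' q' : R) : s = A + C -> C *+ 2 = Ca + Cb - Q ->
      P = A + Ca -> P' = A + Cb -> q' = Q -> s *+ 2 = P + P' - q'.
    by move=> -> CE -> -> ->; rewrite mulrnDl CE mulr2n; ring.
  rewrite [RHS]RE mulmxnE.
  exact: (alg _ _ _ _ _ _ _ _ _ sE chr (etrans (pE a b) (colE a b)) pba
    (bilinE _ _ _ _ _)).
transitivity (\tr (S *m invmx hm)).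
  apply: eq_bigr => a _; rewrite [RHS]mxE; apply: eq_bigr => b _.
  have -> : invmx hm a b = invmx hm b a by rewrite -{1}hT mxE.
  by rewrite mulrC; congr (_ * _); rewrite [RHS]mxE.
suff /eqP : \tr (S *m invmx hm) *+ 2 = 0 by rewrite mulrn_eq0 => /eqP.
have tr2 (X : 'M[R]_m) : \tr ((X *+ 2) *m invmx hm) = \tr (X *m invmx hm) *+ 2.
  by rewrite !mulr2n mulmxDl mxtraceD.
rewrite -tr2 SE mulmxBl mulmxDl raddfB /= mxtraceD.
have -> : \tr (p^T *m invmx hm) = \tr (p *m invmx hm).
  by rewrite -mxtrace_tr trmx_mul trmxK hT mxtrace_mulC.
by have := second_form_trace; rewrite mulmxBl raddfB /= tr2 mulr2n.
Qed.

End InvariantSubmanifold.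

Lemma normal_part_linear {R : realType} {n m : nat} {M : manifold R n} {L : manifold R m}
    (g : riemannian_metric M) (f : L -> M) c c' y w :
  normal_part g f c c' y w = w *m (1%:M - g c' (local_rep f c c' y) *m
    ('J (local_rep f c c') y)^T *m invmx (induced_metric g f c c' y) *m
    'J (local_rep f c c') y).
Proof. by rewrite mulmxBr mulmx1 /normal_part !mulmxA. Qed.

(** Up to a factor the mean curvature vector is [A *m P], where A is the trace of
    the covariant derivatives and P the normal projection.  It is normal, so
    [cov_deriv_trace] applies to it and shows that it is orthogonal to itself. *)
Theorem invariant_submanifold_minimal {R : realType} {n h k m : nat}
    {M : manifold R n} {L : manifold R m} {a1 a2 : one_form M}
    {Z1 Z2 : vector_field M} {phi : endo_field M} {g : riemannian_metric M}
    (f : L -> M) :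
  metric_contact_pair h k a1 a2 Z1 Z2 phi g -> immersion f ->
  (forall c c' z, atlas c -> atlas c' -> local_dom f c c' z ->
    let r := local_rep f c c' in
    [/\ ('J r z *m phi c' (r z) <= 'J r z)%MS, (Z1 c' (r z) <= 'J r z)%MS &
        (Z2 c' (r z) <= 'J r z)%MS]) ->
  minimal_immersion g f.
Proof.
move=> mcp f_imm f_tan; split=> // c c' y Ac Ac' Wy.
pose x := local_rep f c c' y; pose J := 'J (local_rep f c c') y.
pose G := g c' x; pose hm := induced_metric g f c c' y.
have phi_tan z : local_dom f c c' z ->
    ('J (local_rep f c c') z *m phi c' (local_rep f c c' z) <= 'J (local_rep f c c') z)%MS.
  by case/(f_tan c c' z Ac Ac').
have Z1_tan z : local_dom f c c' z ->
    (Z1 c' (local_rep f c c' z) <= 'J (local_rep f c c') z)%MS.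
  by case/(f_tan c c' z Ac Ac').
have Z2_tan z : local_dom f c c' z ->
    (Z2 c' (local_rep f c c' z) <= 'J (local_rep f c c') z)%MS.
  by case/(f_tan c c' z Ac Ac').
have Cx : in_chart c' x := local_dom_in_chart Ac' Wy.
have J_free : row_free J := f_imm.2 c c' y Ac Ac' Wy.
have hunit : hm \in unitmx := posdef_congr_unit (rm_pos g Cx) J_free.
have GT : G^T = G := rm_sym g Cx.
pose P := 1%:M - G *m J^T *m invmx hm *m J.
pose A := \sum_a \sum_b invmx hm a b *: cov_deriv g f c c' y a b.
suff AP : A *m P = 0.
  rewrite /mean_curvature; apply: etrans (scaler0 _ _); congr (_ *: _).
  apply: etrans _ AP.
  rewrite [RHS]mulmx_suml; apply: eq_bigr => a _; rewrite [RHS]mulmx_suml.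
  apply: eq_bigr => b _; rewrite -scalemxAl; congr (_ *: _).
  exact: normal_part_linear.
have P_normal : P *m G *m J^T = 0.
  rewrite /P !mulmxBl mul1mx -!mulmxA (mulmxA J) -/(induced_metric g f c c' y) -/hm.
  by rewrite mulVmx // mulmx1 subrr.
have [N NE] : exists N, N = A *m P by exists (A *m P).
have N_normal : N *m G *m J^T = 0 by rewrite NE -2!(mulmxA A) P_normal mulmx0.
rewrite -NE; apply: (posdef_norm_eq0 (rm_pos g Cx)).
have JN : J *m (G *m N^T) = 0.
  by apply: trmx_inj; rewrite !trmx_mul trmxK GT N_normal trmx0.
have AN : A *m (G *m N^T) = 0.
  apply/matrixP => i j; rewrite !ord1 [RHS]mxE.
  apply: etrans _ (cov_deriv_trace mcp f_imm Ac Ac' phi_tan Z1_tan Z2_tan Wy N_normal).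
  rewrite /A mulmx_suml summxE; apply: eq_bigr => a _; rewrite mulmx_suml summxE.
  by apply: eq_bigr => b _; rewrite -scalemxAl [LHS]mxE mulmxA.
by rewrite -mulmxA {1}NE -mulmxA /P mulmxBl mul1mx -!mulmxA JN !mulmx0 subr0 AN.
Qed.

(** * Leaves of the characteristic foliations *)

Section KernelOfExteriorDerivative.
Context {R : realType} {n : nat} {M : manifold R n} (a : one_form M).
Context (c : chart R n M) (x : 'rV[R]_n) (Cx : in_chart c x).

Lemma ext_d_linear (u1 u2 w : 'rV[R]_n) t :
  ext_d a c x (t *: u1 + u2) w = t * ext_d a c x u1 w + ext_d a c x u2 w.
Proof.
have [Ac Ux] := Cx.
have da : differentiable (a c) x := smooth_on_differentiable (of_smooth a Ac) Ux.
rewrite (ext_dE a Ac _ _ Ux) (ext_dE a Ac u1 w Ux) (ext_dE a Ac u2 w Ux).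
rewrite !deriveE // linearP mulmxDl mulmxDr -scalemxAl -scalemxAr.
have ent (A B : 'M[R]_1) : (t *: A + B) 0 0 = t * A 0 0 + B 0 0 by rewrite !mxE.
by rewrite !ent; ring.
Qed.

(** A vector v of TG differs from v - a(v) Z, which lies in TF, by a multiple of
    Z, and phi kills Z. *)
Lemma TG_invariant (Z : 'rV[R]_n) (phi : 'M[R]_n) v :
  form_eval a c x Z = 1 -> TG a c x Z -> Z *m phi = 0 ->
  (forall w, TF a c x w -> TF a c x (w *m phi)) ->
  TG a c x v -> TG a c x (v *m phi).
Proof.
move=> aZ dZ phiZ TFphi dv.
pose u := - form_eval a c x v *: Z + v.
have -> : v *m phi = u *m phi by rewrite mulmxDl -scalemxAl phiZ scaler0 add0r.
suff /TFphi[_] : TF a c x u by [].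
split=> [|w]; last by rewrite ext_d_linear dZ dv mulr0 addr0.
move: aZ; rewrite /u /form_eval mulmxDl -scalemxAl.
have ent t (A B : 'M[R]_1) : (t *: A + B) 0 0 = t * A 0 0 + B 0 0 by rewrite !mxE.
by rewrite ent => ->; rewrite mulr1 addNr.
Qed.

End KernelOfExteriorDerivative.

Theorem theorem20 (R : realType) (h k : nat)
    (M : manifold R (2 * h + 2 * k + 2)%N)
    (a1 a2 : one_form M) (Z1 Z2 : vector_field M) (phi : endo_field M)
    (g : riemannian_metric M) :
  metric_contact_pair h k a1 a2 Z1 Z2 phi g ->
  decomposable a1 a2 phi ->
  (forall (m : nat) (L : manifold R m) (f : L -> M),
     leaf (TG a1) f -> minimal_immersion g f) /\
  (forall (m : nat) (L : manifold R m) (f : L -> M),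
     leaf (TG a2) f -> minimal_immersion g f).
Proof.
move=> mcp dec.
have mcs := mcp_structure mcp; have reeb := cps_reeb mcs.
have key (a : one_form M) (Z : vector_field M) :
    (forall c x, in_chart c x -> form_eval a c x (Z c x) = 1) ->
    (forall c x, in_chart c x -> Z c x *m phi c x = 0) ->
    (forall c x, in_chart c x -> TG a c x (Z c x)) ->
    (forall c x, in_chart c x -> TG a c x (Z1 c x)) ->
    (forall c x, in_chart c x -> TG a c x (Z2 c x)) ->
    (forall c x, in_chart c x -> forall v, TF a c x v -> TF a c x (v *m phi c x)) ->
    forall m (L : manifold R m) (f : L -> M), leaf (TG a) f -> minimal_immersion g f.
  move=> aZ phiZ TGZ TGZ1 TGZ2 TFphi m L f [cim _].
  apply: (invariant_submanifold_minimal mcp (cim_immersion cim)) => c c' z Ac Ac' Wz r.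
  have Cz : in_chart c' (r z) := local_dom_in_chart Ac' Wz.
  have tangent v : TG a c' (r z) v -> (v <= 'J r z)%MS.
    by case: (cim_tangent cim Ac Ac' Wz v).
  split; [|exact/tangent/TGZ1|exact/tangent/TGZ2].
  apply/row_subP => i; rewrite row_mul; apply: tangent.
  apply: (TG_invariant Cz (aZ _ _ Cz) (TGZ _ _ Cz) (phiZ _ _ Cz) (TFphi _ _ Cz)).
  by apply/(cim_tangent cim Ac Ac' Wz); exact: row_sub.
split.
- apply: (key a1 Z1 (@reeb_11 _ _ _ _ _ _ _ reeb) (@cps_Z1 _ _ _ _ _ _ _ _ _ _ mcs)).
  + exact: (@reeb_d11 _ _ _ _ _ _ _ reeb).
  + exact: (@reeb_d11 _ _ _ _ _ _ _ reeb).
  + exact: (@reeb_d12 _ _ _ _ _ _ _ reeb).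
  + by move=> c x Cx v; case: (dec c x Cx v).
- apply: (key a2 Z2 (@reeb_22 _ _ _ _ _ _ _ reeb) (@cps_Z2 _ _ _ _ _ _ _ _ _ _ mcs)).
  + exact: (@reeb_d22 _ _ _ _ _ _ _ reeb).
  + exact: (@reeb_d21 _ _ _ _ _ _ _ reeb).
  + exact: (@reeb_d22 _ _ _ _ _ _ _ reeb).
  + by move=> c x Cx v; case: (dec c x Cx v).
Qed.
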